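(* Let $F$ be a field of prime characteristic $p$, let $G$ be a group and let $V$ be a finite-dimensional $FG$-module. Let $(B_r)_{r\geq 1}$ be a family of submodules as provided by the Decomposition Theorem; that is, for each positive integer $r$, $B_r$ is an $FG$-submodule of $L^r(V)$ which is a direct summand of the $FG$-module $T^r(V)$, and for every positive integer $k$ not divisible by $p$ and every integer $m\geq 0$, $$L^{p^mk}(V) = L^{p^m}(B_k)\oplus L^{p^{m-1}}(B_{pk})\oplus\cdots\oplus L^1(B_{p^mk}).$$ Then, for every positive integer $k$ not divisible by $p$ and every integer $m\geq 0$, $$R^{p^mk}(V) = R^{p^m}(B_k)\oplus R^{p^{m-1}}(B_{pk})\oplus\cdots\oplus R^1(B_{p^mk}).$$ Here all sums are internal direct sums of submodules of $T^{p^mk}(V)$.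
   Context: $T(V)=\bigoplus_{r\geq 0}T^r(V)$ is the free associative $F$-algebra on (any basis of) $V$, with $r$th homogeneous component $T^r(V)$ and $T^1(V)=V$; the action of $G$ on $V$ extends to $T(V)$ by algebra automorphisms. $T(V)$ is a Lie algebra under $[a,b]=ab-ba$ and, in characteristic $p$, a restricted Lie algebra with $p$-operation $a\mapsto a^p$. $L(V)$ is the Lie subalgebra of $T(V)$ generated by $V$ (it is the free Lie algebra on $V$), and $R(V)$ is the restricted Lie subalgebra of $T(V)$ generated by $V$ (it is the free restricted Lie algebra on $V$). For $r\geq 1$, $L^r(V)=T^r(V)\cap L(V)$ and $R^r(V)=T^r(V)\cap R(V)$; these are $FG$-submodules of $T^r(V)$. Identification convention: if $B$ is an $FG$-submodule of $L^r(V)$ or, more generally, of $T^r(V)$ with $r\geq 1$, then the associative subalgebra of $T(V)$ generated by $B$ is identified with $T(B)$, the Lie subalgebra of $T(V)$ generated by $B$ with $L(B)$, and the restricted Lie subalgebra of $T(V)$ generated by $B$ with $R(B)$. So for $s\geq 1$, $L^s(B)$ and $R^s(B)$ (the $s$th homogeneous components, where elements of $B$ have degree $1$) are submodules of $T^{rs}(V)$. The Decomposition Theorem (a known earlier theorem of the authors) asserts that, for $F$, $G$, $V$ as in the claim, a family $(B_r)_{r\ge 1}$ with the stated properties exists. *)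

(* Defs.v *)
From HB Require Import structures.
From mathcomp Require Import all_boot all_order all_algebra.
From mathcomp Require Import finmap monalg.

Set Implicit Arguments.
Unset Strict Implicit.
Unset Printing Implicit Defensive.

Import GRing.Theory.
Local Open Scope ring_scope.

(* Subspaces are Prop-valued predicates: the subalgebras below are infinite
   dimensional and have no decidable membership a priori.                     *)

Section Subspaces.
Variables (F : fieldType) (A : lmodType F).
Implicit Types X Y : A -> Prop.

Definition is_subspace X :=
  X 0 /\ forall (a : F) x y, X x -> X y -> X (a *: x + y).

Definition span X : A -> Prop :=
  fun x => forall Y, is_subspace Y -> (forall y, X y -> Y y) -> Y x.

Definition internal_direct_sum (I : finType) X (U : I -> A -> Prop) :=
  (forall x, X x <->
     exists u : I -> A, (forall i, U i (u i)) /\ x = \sum_i u i) /\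
  (forall u : I -> A,
     (forall i, U i (u i)) -> \sum_i u i = 0 -> forall i, u i = 0).

End Subspaces.

Section GeneratedAlgebras.
Variables (F : fieldType) (A : algType F).
Implicit Types S X : A -> Prop.

Definition lie_bracket (a b : A) : A := a * b - b * a.

Definition is_lie_subalgebra X :=
  is_subspace X /\ forall a b, X a -> X b -> X (lie_bracket a b).

Definition is_restricted_lie_subalgebra (p : nat) X :=
  is_lie_subalgebra X /\ forall a, X a -> X (a ^+ p).

Definition lie_generated S : A -> Prop :=
  fun x => forall X, is_lie_subalgebra X -> (forall y, S y -> X y) -> X x.

Definition restricted_lie_generated (p : nat) S : A -> Prop :=
  fun x => forall X, is_restricted_lie_subalgebra p X ->
    (forall y, S y -> X y) -> X x.

(* When the subalgebra generated by S is free on S, the three predicates below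
   are T^r(S), L^r(S) and R^r(S), elements of S having degree 1.              *)
Definition tensor_component S (r : nat) : A -> Prop :=
  span (fun x => exists b : 'I_r -> A,
    (forall i, S (b i)) /\ x = \prod_(i < r) b i).

Definition lie_component S (r : nat) : A -> Prop :=
  fun x => tensor_component S r x /\ lie_generated S x.

Definition restricted_lie_component (p : nat) S (r : nat) : A -> Prop :=
  fun x => tensor_component S r x /\ restricted_lie_generated p S x.

End GeneratedAlgebras.

(* The free associative R-algebra on I, i.e. the monoid algebra of the free
   monoid on I. It is an alias of {malg R[{fmonom I}]}, for which monalg gives no
   algType structure; scaling and product are those of malg, locked because
   unification otherwise unfolds them.                                        *)
Definition free_algebra (R : comNzRingType) (I : choiceType) : predArgType :=
  {malg R[{fmonom I}]}.

HB.lock Definition free_scale (R : comNzRingType) (I : choiceType)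
  (k : R) (x : free_algebra R I) : free_algebra R I :=
  k *: (x : {malg R[{fmonom I}]}).

HB.lock Definition free_mul (R : comNzRingType) (I : choiceType)
  (x y : free_algebra R I) : free_algebra R I :=
  (x : {malg R[{fmonom I}]}) * (y : {malg R[{fmonom I}]}).

HB.instance Definition _ (R : comNzRingType) (I : choiceType) :=
  GRing.Zmodule.copy (free_algebra R I) {malg R[{fmonom I}]}.

Section FreeAlgebra.
Variables (R : comNzRingType) (I : choiceType).
Local Notation A := (free_algebra R I).
Local Notation M := {malg R[{fmonom I}]}.
Local Notation scale := (@free_scale R I).
Local Notation mul := (@free_mul R I).

Lemma free_scalerA (a b : R) (x : A) : scale a (scale b x) = scale (a * b) x.
Proof. by rewrite free_scale.unlock; apply: (@scalerA R M). Qed.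

Lemma free_scale1r : left_id 1 scale.
Proof. by rewrite free_scale.unlock; apply: (@scale1r R M). Qed.

Lemma free_scalerDr : right_distributive scale +%R.
Proof. by rewrite free_scale.unlock; apply: (@scalerDr R M). Qed.

Lemma free_scalerDl (x : A) : {morph scale^~ x : a b / a + b}.
Proof. by move=> a b; rewrite free_scale.unlock; apply: (@scalerDl R M). Qed.

HB.instance Definition _ := GRing.Zmodule_isLmodule.Build R A
  free_scalerA free_scale1r free_scalerDr free_scalerDl.

Lemma free_mulA : associative mul.
Proof. by rewrite free_mul.unlock; apply: (@mulrA M). Qed.

Lemma free_mul1r : left_id (1 : M) mul.
Proof. by rewrite free_mul.unlock; apply: (@mul1r M). Qed.

Lemma free_mulr1 : right_id (1 : M) mul.
Proof. by rewrite free_mul.unlock; apply: (@mulr1 M). Qed.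

Lemma free_mulDl : left_distributive mul +%R.
Proof. by rewrite free_mul.unlock; apply: (@mulrDl M). Qed.

Lemma free_mulDr : right_distributive mul +%R.
Proof. by rewrite free_mul.unlock; apply: (@mulrDr M). Qed.

Lemma free_oner_neq0 : (1 : M) != 0.
Proof. exact: oner_neq0. Qed.

HB.instance Definition _ := GRing.Zmodule_isNzRing.Build A
  free_mulA free_mul1r free_mulr1 free_mulDl free_mulDr free_oner_neq0.

Lemma free_scalerAl (k : R) (x y : A) : k *: mul x y = mul (k *: x) y.
Proof.
rewrite /GRing.scale /= free_scale.unlock free_mul.unlock.
exact: (@scalerAl R M).
Qed.

HB.instance Definition _ := GRing.Lmodule_isLalgebra.Build R A free_scalerAl.

Lemma free_scalerAr (k : R) (x y : A) : k *: mul x y = mul x (k *: y).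
Proof.
rewrite /GRing.scale /= free_scale.unlock free_mul.unlock; apply/malgP => w.
rewrite mcoeffZ (mcoeffMlw _ (fsubset_refl _) (fsubset_refl _)).
rewrite (mcoeffMlw _ (fsubset_refl _) (msuppZ_le _ _)) mulr_sumr.
apply: eq_bigr => u _; rewrite mulr_sumr; apply: eq_bigr => v _.
by rewrite mcoeffZ mulrnAr mulrCA.
Qed.

HB.instance Definition _ := GRing.Lalgebra_isAlgebra.Build R A free_scalerAr.

Lemma free_scaleE (k : R) (x : A) : k *: x = k *: (x : M) :> M.
Proof. by rewrite [LHS]/GRing.scale /= free_scale.unlock. Qed.

Lemma free_mulE (x y : A) : x * y = (x : M) * (y : M) :> M.
Proof. by rewrite [LHS]/GRing.mul /= free_mul.unlock. Qed.

Definition free_generator (i : I) : A := << fmu i >>.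

Lemma free_word (s : seq I) :
  \prod_(i <- s) free_generator i = << FMonom s >> :> M.
Proof.
elim: s => [|i s IHs]; first by rewrite big_nil -fmoneE.
rewrite big_cons free_mulE IHs malgM_def fgmulUU mulr1.
by congr << _ >>; rewrite /mmul /= fmmulE fmU.
Qed.

End FreeAlgebra.

(* T(V), on the index set of the basis (vbasis {:V}) of V                     *)
Definition tensor_algebra (F : fieldType) (V : vectType F) : algType F :=
  free_algebra F 'I_(\dim {:V}).

Definition tensor_vector (F : fieldType) (V : vectType F) (v : V) :
  tensor_algebra V :=
  \sum_i coord (vbasis {:V}) i v *: free_generator F i.

(* The algebra endomorphism of T(V) extending the endomorphism f of V         *)
Definition tensor_map_word (F : fieldType) (V : vectType F) (f : 'End(V))
  (w : {fmonom 'I_(\dim {:V})}) : tensor_algebra V :=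
  \prod_(i <- (w : seq _)) tensor_vector (f (vbasis {:V})`_i).

HB.lock Definition tensor_map (F : fieldType) (V : vectType F) (f : 'End(V))
  (x : tensor_algebra V) : tensor_algebra V :=
  mmap (in_alg (tensor_algebra V)) (tensor_map_word f) x.

Section TensorMap.
Variables (F : fieldType) (V : vectType F) (f : 'End(V)).
Local Notation tensor_map_word := (tensor_map_word f).
Local Notation tensor_map := (tensor_map f).

Lemma tensor_map_word_mmorphism : mmorphism tensor_map_word.
Proof.
split=> [u v|]; first by rewrite /tensor_map_word fmM big_cat.
by rewrite /tensor_map_word fm1 big_nil.
Qed.

HB.instance Definition _ :=
  monalg.isMultiplicative.Build _ _ tensor_map_word tensor_map_word_mmorphism.

Lemma tensor_map_is_linear : linear tensor_map.
Proof.
by move=> a x y; rewrite tensor_map.unlock raddfD /= free_scaleE mmapZ mulr_algl.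
Qed.

Lemma tensor_map_is_monoid_morphism : monoid_morphism tensor_map.
Proof.
rewrite tensor_map.unlock.
have [|fM f1] := @commr_mmap_is_multiplicative _ _ _
    (in_alg (tensor_algebra V)) tensor_map_word.
  by move=> x u v; rewrite /GRing.comm /= mulr_algl mulr_algr.
by split=> // x y; rewrite free_mulE fM.
Qed.

HB.instance Definition _ :=
  GRing.isLinear.Build F (tensor_algebra V) (tensor_algebra V) *:%R tensor_map
    tensor_map_is_linear.
HB.instance Definition _ :=
  GRing.isMonoidMorphism.Build (tensor_algebra V) (tensor_algebra V) tensor_map
    tensor_map_is_monoid_morphism.

Lemma tensor_map_vector (v : V) :
  tensor_map (tensor_vector v) = tensor_vector (f v).
Proof.
have tvP : linear (@tensor_vector F V).
  move=> a u w; rewrite /tensor_vector scaler_sumr -big_split /=.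
  by apply: eq_bigr => i _; rewrite linearP scalerDl scalerA.
pose tv : {linear V -> tensor_algebra V} :=
  HB.pack (@tensor_vector F V) (GRing.isLinear.Build _ _ _ _ _ tvP).
have -> : f v = \sum_i coord (vbasis {:V}) i v *: f (vbasis {:V})`_i.
  rewrite {1}(coord_vbasis (memvf v)) linear_sum.
  by apply: eq_bigr => i _; rewrite linearZ.
rewrite linear_sum -[RHS]/(tv _) linear_sum.
apply: eq_bigr => i _.
rewrite !linearZ /=; congr (_ *: _).
rewrite tensor_map.unlock /free_generator mmapU /= scale1r mul1r.
by rewrite /tensor_map_word fmU big_seq1.
Qed.

End TensorMap.

Section Modules.
Variables (F : fieldType) (G : groupType) (V : vectType F).
Variable rho : G -> 'End(V).
Implicit Types X Y : tensor_algebra V -> Prop.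

Definition is_linear_action :=
  rho 1%g = \1%VF /\ forall g h : G, rho (g * h)%g = (rho g \o rho h)%VF.

Definition is_FG_submodule X :=
  is_subspace X /\ forall g x, X x -> X (tensor_map (rho g) x).

Definition is_direct_summand X Y :=
  is_FG_submodule Y /\
  exists2 Z, is_FG_submodule Z &
    internal_direct_sum X (fun b : bool => if b then Y else Z).

End Modules.

(* V = T^1(V) inside T(V)                                                     *)
Definition degree_one (F : fieldType) (V : vectType F) :
  tensor_algebra V -> Prop :=
  fun x => exists v : V, x = tensor_vector v.
Arguments degree_one {F} V _.

Section GeneratedClosure.
Variables (F : fieldType) (A : algType F).
Implicit Types S X : A -> Prop.

Lemma span_subspace S : is_subspace (span S).
Proof.
split=> [X [] //|a x y Sx Sy X XS SX].
by apply: (XS.2); [apply: Sx | apply: Sy].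
Qed.

Lemma sub_span S x : S x -> span S x.
Proof. by move=> Sx X _; apply. Qed.

Lemma lie_generated_subspace S : is_subspace (lie_generated S).
Proof.
split=> [X [[]] //|a x y Sx Sy X XS SX].
by apply: (XS.1.2); [apply: Sx | apply: Sy].
Qed.

Lemma restricted_lie_generated_subspace p S :
  is_subspace (restricted_lie_generated p S).
Proof.
split=> [X [[[]]] //|a x y Sx Sy X XS SX].
by apply: (XS.1.1.2); [apply: Sx | apply: Sy].
Qed.

End GeneratedClosure.

Section ComponentSubmodules.
Variables (F : fieldType) (V : vectType F) (f : 'End(V)).
Variable S : tensor_algebra V -> Prop.
Hypothesis fS : forall x, S x -> S (tensor_map f x).

Lemma preim_subspace X : is_subspace X ->
  is_subspace (fun x : tensor_algebra V => X (tensor_map f x)).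
Proof.
move=> [X0 XP]; split=> [|a x y Xx Xy]; first by rewrite linear0.
by rewrite tensor_map_is_linear; apply: XP.
Qed.

Lemma preim_lie_subalgebra X : is_lie_subalgebra X ->
  is_lie_subalgebra (fun x : tensor_algebra V => X (tensor_map f x)).
Proof.
move=> [XS XL]; split=> [|a b Xa Xb]; first exact: preim_subspace.
by rewrite /lie_bracket raddfB /= !rmorphM; exact: (XL _ _ Xa Xb).
Qed.

Lemma tensor_component_stable r x :
  tensor_component S r x -> tensor_component S r (tensor_map f x).
Proof.
move=> Tx; apply: (Tx (fun y => tensor_component S r (tensor_map f y))).
  exact: preim_subspace (span_subspace _).
move=> _ [b [bS ->]]; rewrite rmorph_prod; apply: sub_span.
by exists (fun i => tensor_map f (b i)); split=> // i; apply: fS.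
Qed.

Lemma lie_generated_stable x :
  lie_generated S x -> lie_generated S (tensor_map f x).
Proof.
move=> Sx X XL SX; apply: (Sx (fun y => X (tensor_map f y))).
  exact: preim_lie_subalgebra.
by move=> y /fS /SX.
Qed.

Lemma restricted_lie_generated_stable p x :
  restricted_lie_generated p S x ->
  restricted_lie_generated p S (tensor_map f x).
Proof.
move=> Sx X [XL Xp] SX; apply: (Sx (fun y => X (tensor_map f y))); last by move=> y /fS /SX.
split=> [|a Xa]; first exact: preim_lie_subalgebra.
by rewrite rmorphXn; apply: Xp.
Qed.

End ComponentSubmodules.

Lemma is_subspaceI (F : fieldType) (A : lmodType F) (X Y : A -> Prop) :
  is_subspace X -> is_subspace Y -> is_subspace (fun x => X x /\ Y x).
Proof.
move=> [X0 XP] [Y0 YP]; split=> // a x y [Xx Yx] [Xy Yy].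
by split; [apply: XP | apply: YP].
Qed.

Section Submodules.
Variables (F : fieldType) (G : groupType) (V : vectType F).
Variable rho : G -> 'End(V).

Lemma lie_component_FG_submodule (B : tensor_algebra V -> Prop) r :
  is_FG_submodule rho B -> is_FG_submodule rho (lie_component B r).
Proof.
move=> [_ Bst]; split=> [|g x [Tx Lx]].
  by apply: is_subspaceI; [apply: span_subspace | apply: lie_generated_subspace].
split; first by apply: tensor_component_stable => //; apply: Bst.
by apply: lie_generated_stable => //; apply: Bst.
Qed.

Lemma restricted_lie_component_FG_submodule p (B : tensor_algebra V -> Prop) r :
  is_FG_submodule rho B ->
  is_FG_submodule rho (restricted_lie_component p B r).
Proof.
move=> [_ Bst]; split=> [|g x [Tx Lx]].
  apply: is_subspaceI; first exact: span_subspace.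
  exact: restricted_lie_generated_subspace.
split; first by apply: tensor_component_stable => //; apply: Bst.
by apply: restricted_lie_generated_stable => //; apply: Bst.
Qed.

End Submodules.

Section Homogeneous.
Variables (F : fieldType) (V : vectType F).
Implicit Type x : tensor_algebra V.

(* x is a combination of words of length r                                    *)
Definition homogeneous (r : nat) x :=
  forall w : {fmonom 'I_(\dim {:V})}, mcoeff w x != 0 -> size w = r.

Lemma homogeneous_subspace r : is_subspace (homogeneous r).
Proof.
split=> [w|a x y Hx Hy w]; first by rewrite mcoeff0 eqxx.
rewrite mcoeffD free_scaleE mcoeffZ; case: (eqVneq (mcoeff w x) 0) => [->|/Hx //].
by rewrite mulr0 add0r => /Hy.
Qed.

Lemma homogeneousM r s x y :
  homogeneous r x -> homogeneous s y -> homogeneous (r + s) (x * y).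
Proof.
move=> Hx Hy w; rewrite free_mulE mcoeff_neq0 => /msuppM_le [u [v]].
rewrite -!mcoeff_neq0 => -[/Hx <- /Hy <- ->].
by rewrite fmM size_cat.
Qed.

Lemma homogeneous_prod r s (b : 'I_s -> tensor_algebra V) :
  (forall i, homogeneous r (b i)) -> homogeneous (s * r) (\prod_(i < s) b i).
Proof.
elim: s b => [|s IHs] b Hb.
  rewrite big_ord0 => w; rewrite mcoeff1.
  by have [->|_] := eqVneq w mone; [rewrite fm1 | rewrite eqxx].
by rewrite big_ord_recl mulSn; apply: homogeneousM; last exact: IHs.
Qed.

Lemma homogeneous_vector (v : V) : homogeneous 1 (tensor_vector v).
Proof.
move=> w; apply: contra_neq_eq => sw; rewrite /tensor_vector raddf_sum /=.
rewrite big1 // => i _; rewrite free_scaleE mcoeffZ mcoeffU.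
have [wE|_] := eqVneq (fmu i) w; last by rewrite mulr0.
by rewrite -wE fmU in sw.
Qed.

Lemma tensor_vector_basis (i : 'I_(\dim {:V})) :
  tensor_vector (vbasis {:V})`_i = free_generator F i.
Proof.
have vb := basis_free (vbasisP {:V}).
rewrite /tensor_vector (bigD1 i) //= coord_free // eqxx scale1r.
rewrite big1 ?addr0 // => j; rewrite coord_free // => /negPf.
by rewrite eq_sym => ->; rewrite scale0r.
Qed.

Lemma homogeneousE r x :
  tensor_component (degree_one V) r x <-> homogeneous r x.
Proof.
split=> [|Hx].
  apply; first exact: homogeneous_subspace.
  move=> _ [b [bV ->]]; have := @homogeneous_prod 1 r b; rewrite muln1; apply => i.
  by have [v ->] := bV i; apply: homogeneous_vector.
rewrite [x]monalgE big_seq; set T := tensor_component _ r.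
have [T0 TD] : is_subspace T by apply: span_subspace.
apply: (big_ind T) => // [y z Ty Tz|w].
  by rewrite -[y]scale1r; apply: TD.
rewrite -mcoeff_neq0 => /Hx sw.
pose gw : tensor_algebra V := << w >>.
have -> : << mcoeff w x *g w >> = mcoeff w x *: gw + 0.
  rewrite addr0; apply/malgP => u.
  by rewrite free_scaleE mcoeffZ !mcoeffU mulr_natr.
apply: TD => //; apply: sub_span.
pose t : r.-tuple 'I_(\dim {:V}) := Tuple (introT eqP sw).
exists (fun i => tensor_vector (vbasis {:V})`_(tnth t i)).
split=> [i|]; first by eexists.
transitivity (\prod_(i <- t) tensor_vector (vbasis {:V})`_i); last first.
  exact: big_tuple.
rewrite (eq_bigr (@free_generator F _)) => [|i _]; last first.
  exact: tensor_vector_basis.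
by rewrite free_word /= fmK.
Qed.

Lemma tensor_component_sub r s (S : tensor_algebra V -> Prop) x :
  (forall y, S y -> tensor_component (degree_one V) r y) ->
  tensor_component S s x -> tensor_component (degree_one V) (s * r) x.
Proof.
move=> ST Sx; apply/homogeneousE; apply: Sx; first exact: homogeneous_subspace.
move=> _ [b [bS ->]]; apply: homogeneous_prod => i.
by apply/homogeneousE; apply: ST.
Qed.

End Homogeneous.

(* Main.v *)
Require Import Defs.
From HB Require Import structures.
From mathcomp Require Import all_boot all_order all_algebra.
From mathcomp Require Import finmap monalg.

Set Implicit Arguments.
Unset Strict Implicit.
Unset Printing Implicit Defensive.

(* Gives span its meaning for predicates precedence over that for sequences. *)
Import Defs.
Import GRing.Theory.
Local Open Scope ring_scope.

(** Let T be the tensor algebra of V and write L for Lie elements, R for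
    restricted Lie elements.  Modulo Lie elements the map a |-> a ^+ p is
    semilinear (Jacobson's formula, [jacobson_formula]) and a power a ^+ p acts
    on Lie elements by the p-th iterate of the bracket with a.  Hence R is
    spanned by the powers a ^+ (p ^ j) of homogeneous a in L, for T itself as
    well as for the subalgebra generated by each B_i
    ([restricted_power_span]).

    That the summands span R is then immediate: in a power a ^+ (p ^ J) of a
    Lie element a, decompose a into elements of the Lie components of the B_i;
    up to powers with a smaller exponent, a ^+ (p ^ J) is the sum of the powers
    of these elements, and induction on J applies ([restricted_spanned]).

    That the sum is direct rests on the fact that powers a ^+ (p ^ J) of
    linearly independent a in L, all of degree d, are linearly independent
    modulo the span of the powers b ^+ (p ^ j) with b in L and j < J of the same
    total degree.  This is a part of the Poincare-Birkhoff-Witt theorem for L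
    inside T, and it has the following direct proof.  Let q = p ^ J.  Give T the
    coproduct for which letters are primitive; a functional f supported in
    degree d acts on T by contraction, and the divided power of order q of that
    contraction, which counts unordered families of q disjoint subwords, exists
    over every ring.  Taking the coefficient of the empty word yields a
    functional [divided_power f q] that maps a ^+ q to f a ^+ q for a in L of
    degree d and kills all powers of Lie elements of degree larger than d
    ([divided_power_lie], [divided_power_lie_eq0]).  The proof needs no
    coproduct: the rules for moving a contraction past left multiplication by a
    letter are defining recursions, and the elements for which they hold form a
    Lie subalgebra ([primitive_at_bracket]).

    Now suppose that elements of the summands add up to 0.  By the
    decomposition of L, linear independence inside the Lie components of the
    single B_i gives linear independence of all the Lie elements whose q-th
    powers occur with the highest exponent q.  Separating functionals f show
    that these q-th powers do not occur after all, so the highest exponent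
    drops until nothing is left ([layer_span_drop],
    [power_spans_independent]). *)

(** * Subspaces *)

Section Subspaces.
Variables (F : fieldType) (A : lmodType F).
Implicit Types (X Y : A -> Prop).

Lemma subspaceD X x y : is_subspace X -> X x -> X y -> X (x + y).
Proof. by move=> [_ XD] Xx; rewrite -[x]scale1r; apply: XD. Qed.

Lemma subspaceZ X c x : is_subspace X -> X x -> X (c *: x).
Proof. by move=> [X0 XD] Xx; rewrite -[_ *: _]addr0; apply: XD. Qed.

Lemma subspaceB X x y : is_subspace X -> X x -> X y -> X (x - y).
Proof. by move=> XS Xx Xy; rewrite addrC -scaleN1r; apply: (XS.2). Qed.

Lemma subspace_sum (I : Type) (r : seq I) (P : pred I) (E : I -> A) X :
  is_subspace X -> (forall i, P i -> X (E i)) -> X (\sum_(i <- r | P i) E i).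
Proof.
by move=> XS XE; apply: (big_ind X) => //; [case: XS | move=> *; apply: subspaceD].
Qed.

End Subspaces.

(** * Divided powers of contractions *)

Section Contractions.
Variables (F : fieldType) (I : choiceType).
Local Notation A := (free_algebra F I).
Local Notation gen := (@free_generator F I).
Implicit Types (f g : A -> F) (a x : A) (i : I) (s : seq I).

Definition word s : A := \prod_(i <- s) gen i.

Lemma word_cons i s : word (i :: s) = gen i * word s.
Proof. exact: big_cons. Qed.

Lemma free_algebra_ind (P : A -> Prop) :
  is_subspace P -> (forall s, P (word s)) -> forall x, P x.
Proof.
move=> [P0 PD] Pw x; rewrite [x]monalgE; apply: (big_ind P) => // [y z Py Pz|w _].
  by rewrite -[y]scale1r; apply: PD.
have -> : << mcoeff w x *g w >> = mcoeff w x *: word (w : seq I) + 0 :> A.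
  rewrite addr0 /word free_word fmK; apply/malgP => u.
 rewrite free_scaleE mcoeffZ.
rewrite [RHS]/=.
rewrite [X in _ * X]mcoeffU1.
rewrite [LHS]mcoeffU. exact/esym/mulr_natr.
exact: PD.
Qed.

Lemma mcoeff_word s s' : mcoeff (FMonom s) (word s') = (s' == s)%:R.
Proof. by rewrite /word free_word mcoeffU fmP. Qed.

Lemma mcoeff_linear w : scalar (fun x : A => mcoeff w x).
Proof. by move=> c x y; rewrite mcoeffD free_scaleE mcoeffZ. Qed.

Definition word_extension (h : seq I -> A) x : A :=
  mmap (in_alg A) (fun w : {fmonom I} => h w) x.

Lemma word_extension_linear h : linear (word_extension h).
Proof.
move=> c x y; rewrite /word_extension raddfD /= free_scaleE; congr (_ + _).
rewrite (mmapEw (msuppZ_le _ _)) mmapE scaler_sumr; apply: eq_bigr => w _.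
by rewrite mcoeffZ /= !mulr_algl scalerA.
Qed.

HB.instance Definition _ h :=
  GRing.isLinear.Build F A A *:%R (word_extension h) (word_extension_linear h).

Lemma word_extensionE h s : word_extension h (word s) = h s.
Proof. by rewrite /word_extension /word free_word mmapU /= mulr_algl scale1r. Qed.

(** The coproduct of the free algebra for which letters are primitive sends a
    word to the sum of all pairs (subword, complementary subword); contraction
    by g evaluates g on the first component.  The recursion sorts these pairs
    by the side to which the first letter goes. *)
Fixpoint contract_word g s : A :=
  if s is i :: s' then
    gen i * contract_word g s' + contract_word (fun x => g (gen i * x)) s'
  else (g 1)%:A.

Definition contract g : A -> A := word_extension (contract_word g).

HB.instance Definition _ g := GRing.Linear.on (contract g).

Lemma word_nil : word [::] = 1.
Proof. exact: big_nil. Qed.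

Lemma contract1 g : contract g 1 = (g 1)%:A.
Proof. by rewrite -{1}word_nil /contract word_extensionE. Qed.

Lemma contract_gen g i x : contract g (gen i * x) =
  gen i * contract g x + contract (fun y => g (gen i * y)) x.
Proof.
elim/free_algebra_ind: x => [|s].
  split=> [|c x y IHx IHy]; first by rewrite mulr0 !linear0 mulr0 addr0.
  rewrite mulrDr -scalerAr !linearP /= IHx IHy mulrDr -scalerAr scalerDr.
  by rewrite addrACA.
by rewrite -word_cons /contract !word_extensionE.
Qed.

(** This is cocommutativity of the coproduct. *)
Lemma contract_comm g g' x :
  contract g (contract g' x) = contract g' (contract g x).
Proof.
elim/free_algebra_ind: x g g' => [|s].
  split=> [|c x y IHx IHy] g g'; first by rewrite !linear0.
  by rewrite !linearP /= IHx IHy.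
elim: s => [|i s IHs] g g'.
  rewrite word_nil !contract1 !linearZ /= !contract1 !scalerA.
  by congr (_ *: _); apply: mulrC.
rewrite word_cons !contract_gen !linearD /= !contract_gen.
by rewrite (IHs g g') [RHS]addrAC; congr (_ + _ + _); apply: IHs.
Qed.

Lemma eq_contract g g' x : (forall s, g (word s) = g' (word s)) ->
  contract g x = contract g' x.
Proof.
move=> gg'; elim/free_algebra_ind: x => [|s].
  by split=> [|c x y IHx IHy]; rewrite ?linear0 // !linearP /= IHx IHy.
rewrite /contract !word_extensionE; elim: s g g' gg' => [|i s IHs] g g' gg' /=.
  by rewrite -word_nil gg'.
by congr (_ * _ + _); apply: IHs => // s'; rewrite -word_cons gg'.
Qed.

Lemma contract_combine c g g' x :
  contract (fun y => c * g y + g' y) x = c *: contract g x + contract g' x.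
Proof.
elim/free_algebra_ind: x => [|s].
  split=> [|d x y IHx IHy]; first by rewrite !linear0 addr0.
  rewrite !linearP /= IHx IHy !scalerDr !scalerA (mulrC d) -!scalerA.
  by rewrite addrACA.
rewrite /contract !word_extensionE; elim: s g g' => [|i s IHs] g g' /=.
  by rewrite scalerDl scalerA.
by rewrite !IHs mulrDr -scalerAr scalerDr addrACA.
Qed.

Lemma contract_eq0 g x : (forall s, g (word s) = 0) -> contract g x = 0.
Proof.
move=> g0; (* g agrees with - g + g on words, and contraction is additive in g. *)
rewrite (@eq_contract g (fun y => -1 * g y + g y)) => [|s].
  by rewrite contract_combine scaleN1r addNr.
by rewrite g0 mulr0 addr0.
Qed.

Lemma contract_counit g x : (forall s, s != [::] -> g (word s) = 0) ->
  contract g x = g 1 *: x.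
Proof.
move=> g0; elim/free_algebra_ind: x => [|s].
  split=> [|c x y IHx IHy]; first by rewrite !linear0.
  by rewrite linearP /= IHx IHy scalerDr !scalerA mulrC.
elim: s => [|i s IHs]; first by rewrite word_nil contract1.
rewrite word_cons contract_gen IHs -scalerAr contract_eq0 ?addr0 // => s'.
by rewrite -word_cons g0.
Qed.

Lemma scalar_mull g a : scalar g -> scalar (fun x => g (a * x)).
Proof. by move=> g_lin c x y; rewrite mulrDr -scalerAr g_lin. Qed.

(** When f 1 = 0, this is the composite of q contractions by f divided by q!.
    Dividing is impossible in small characteristic, but the composite sums over
    ordered families of q disjoint subwords, and summing over unordered families
    instead gives an integral formula: the first letter is either in no member
    of the family or in exactly one, whose remaining letters are removed by a
    single contraction. *)
Fixpoint divided_word f q s : A :=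
  if q is q'.+1 then
    (if s is i :: s' then gen i * divided_word f q s'
       + contract (fun x => f (gen i * x)) (divided_word f q' s')
     else 0)
  else word s.

Definition divided_contract f q : A -> A := word_extension (divided_word f q).

HB.instance Definition _ f q := GRing.Linear.on (divided_contract f q).

Lemma divided_contract0 f x : divided_contract f 0 x = x.
Proof.
elim/free_algebra_ind: x => [|s].
  by split=> [|c x y IHx IHy]; rewrite ?linear0 // linearP /= IHx IHy.
by rewrite /divided_contract word_extensionE; case: s.
Qed.

Lemma divided_contract1 f q : divided_contract f q.+1 1 = 0.
Proof. by rewrite -word_nil /divided_contract word_extensionE. Qed.

Lemma divided_contract_gen f q i x : divided_contract f q.+1 (gen i * x) =
  gen i * divided_contract f q.+1 x
  + contract (fun y => f (gen i * y)) (divided_contract f q x).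
Proof.
elim/free_algebra_ind: x => [|s].
  split=> [|c x y IHx IHy]; first by rewrite mulr0 !linear0 mulr0 addr0.
  rewrite mulrDr -scalerAr !linearP /= IHx IHy mulrDr -scalerAr scalerDr.
  by rewrite addrACA.
by rewrite -word_cons /divided_contract !word_extensionE.
Qed.

(** The rules by which a primitive element a passes contractions and the divided
    contractions by f; for a letter they are the defining recursions. *)
Definition primitive_at f a :=
  (forall g x, scalar g -> contract g (a * x) =
     a * contract g x + contract (fun y => g (a * y)) x) /\
  (forall q x, divided_contract f q.+1 (a * x) =
     a * divided_contract f q.+1 x
     + contract (fun y => f (a * y)) (divided_contract f q x)).

Lemma scalar0 g : scalar g -> g 0 = 0.
Proof.
move=> g_lin; have := g_lin (-1) 0 0.
by rewrite scaler0 addr0 mulN1r addNr.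
Qed.

Lemma contract_mull_combine g c a b x : scalar g ->
  contract (fun y => g ((c *: a + b) * y)) x =
  c *: contract (fun y => g (a * y)) x + contract (fun y => g (b * y)) x.
Proof.
move=> g_lin; rewrite -contract_combine; apply: eq_contract => s.
by rewrite mulrDl -scalerAl g_lin.
Qed.

Lemma contract_mull_bracket g a b x : scalar g ->
  contract (fun y => g (lie_bracket a b * y)) x =
  contract (fun y => g (a * (b * y))) x - contract (fun y => g (b * (a * y))) x.
Proof.
move=> g_lin; rewrite addrC -scaleN1r -contract_combine; apply: eq_contract => s.
by rewrite -g_lin scaleN1r addrC mulrBl !mulrA.
Qed.

Lemma primitive_at_subspace f : scalar f -> is_subspace (primitive_at f).
Proof.
move=> f_lin; split.
  split=> [g x g_lin|q x]; rewrite !mul0r linear0 contract_eq0 ?addr0 // => s.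
    by rewrite mul0r scalar0.
  by rewrite mul0r scalar0.
move=> c a b [aC aD] [bC bD]; split=> [g x g_lin|q x].
  rewrite !mulrDl -!scalerAl linearP /= aC // bC // contract_mull_combine //.
  by rewrite scalerDr addrACA.
rewrite !mulrDl -!scalerAl linearP /= aD // bD // contract_mull_combine //.
by rewrite scalerDr addrACA.
Qed.

Lemma cross_cancel (M : zmodType) (p p' u v w w' z : M) :
  p + u + (v + w + z) - (p' + v + (u + w' + z)) = p - p' + (w - w').
Proof.
rewrite [X in X - _](AC (2*3) ((1*4)*(2*3*5))).
rewrite [X in _ - X](AC (2*3) ((1*4)*(3*2*5))) /=.
by rewrite [p' + w' + _]addrC addrKA opprD addrACA.
Qed.

Lemma cross_cancel0 (M : zmodType) (p p' u v w w' : M) :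
  p + u + (v + w) - (p' + v + (u + w')) = p - p' + (w - w').
Proof. by rewrite -(cross_cancel p p' u v w w' 0) !addr0. Qed.

(** In a commutator all mixed terms are symmetric in a and b and cancel; for the
    term with two contractions this is [contract_comm]. *)
Lemma primitive_at_bracket f a b : scalar f ->
  primitive_at f a -> primitive_at f b -> primitive_at f (lie_bracket a b).
Proof.
move=> f_lin [aC aD] [bC bD].
have commutator g x : scalar g -> contract g (lie_bracket a b * x) =
    lie_bracket a b * contract g x + contract (fun y => g (lie_bracket a b * y)) x.
  move=> g_lin; rewrite contract_mull_bracket // /lie_bracket !mulrBl linearB /=.
  rewrite -!mulrA (aC _ _ g_lin) !(bC _ _ g_lin) (aC _ _ g_lin) !mulrDr.
  rewrite (bC _ _ (scalar_mull a g_lin)) (aC _ _ (scalar_mull b g_lin)).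
  exact: cross_cancel0.
(* The order is q.+1; a term with two contractions occurs only if q > 0. *)
split=> // q x; have faP := scalar_mull a f_lin; have fbP := scalar_mull b f_lin.
rewrite contract_mull_bracket // /lie_bracket !mulrBl linearB /= -!mulrA.
rewrite !(aD, bD) !mulrDr; case: q => [|q].
  rewrite !divided_contract0 (aC _ _ fbP) (bC _ _ faP).
  exact: cross_cancel0.
rewrite !(aD, bD) ![contract _ (_ + _)]linearD /= (aC _ _ fbP) (bC _ _ faP).
by rewrite (contract_comm (fun y => f (a * y))) cross_cancel.
Qed.

Lemma primitive_at_generated f S a :
  scalar f -> (forall x, S x -> primitive_at f x) ->
  lie_generated S a -> primitive_at f a.
Proof.
move=> f_lin SP /(_ (primitive_at f)); apply=> //.
split; first exact: primitive_at_subspace.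
by move=> ? ?; apply: primitive_at_bracket.
Qed.

Lemma primitive_at_gen f i : primitive_at f (gen i).
Proof.
split=> [g x _|q x]; first exact: contract_gen.
exact: divided_contract_gen.
Qed.

Definition divided_power f q x : F := mcoeff (FMonom [::]) (divided_contract f q x).

Lemma divided_power_linear f q : scalar (divided_power f q).
Proof. by move=> c x y; rewrite /divided_power linearP mcoeff_linear. Qed.

Lemma divided_contract_exp_eq0 f a r q : primitive_at f a ->
  (forall s, f (a * word s) = 0) -> divided_contract f q.+1 (a ^+ r) = 0.
Proof.
move=> [_ aD] fa0; elim: r => [|r IHr]; first exact: divided_contract1.
by rewrite exprS aD IHr mulr0 contract_eq0 ?addr0.
Qed.

(** Under these hypotheses contraction by [fun y => f (a * y)] is multiplication
    by the scalar f a, so the divided contractions of a ^+ r satisfy Pascal's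
    recursion, with a and f a as weights. *)
Lemma divided_contract_exp f a : primitive_at f a ->
  (forall s, s != [::] -> f (a * word s) = 0) ->
  forall r, (forall q, (r < q)%N -> divided_contract f q (a ^+ r) = 0) /\
  divided_contract f r (a ^+ r) = (f a ^+ r)%:A.
Proof.
move=> [_ aD] fa0; elim=> [|r [IH0 IH1]].
  split=> [[|q] // _|]; first exact: divided_contract1.
  by rewrite divided_contract0 scale1r.
split=> [[|q] // rq|].
  rewrite exprS aD contract_counit // !IH0 ?mulr0 ?scaler0 ?addr0 //.
  exact: ltnW.
rewrite exprS aD IH0 // mulr0 add0r contract_counit // IH1 mulr1.
by rewrite scalerA -exprS.
Qed.

Lemma divided_power_exp_eq0 f a r q : primitive_at f a -> (0 < q)%N ->
  (forall s, f (a * word s) = 0) -> divided_power f q (a ^+ r) = 0.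
Proof.
case: q => // q aP _ fa0.
by rewrite /divided_power divided_contract_exp_eq0 // mcoeff0.
Qed.

Lemma divided_power_exp f a q : primitive_at f a ->
  (forall s, s != [::] -> f (a * word s) = 0) ->
  divided_power f q (a ^+ q) = f a ^+ q.
Proof.
move=> aP fa0; have [_ E] := divided_contract_exp aP fa0 q.
rewrite /divided_power E -[_%:A]addr0 mcoeff_linear mcoeff0 addr0 -word_nil.
by rewrite mcoeff_word eqxx mulr1.
Qed.

End Contractions.

(** * Jacobson's formula *)

Section Commutators.
Variables (R : nzRingType) (x a : R).
Local Notation T i j := (x ^+ i * a * x ^+ j).
Local Notation c n i := ((-1) ^+ i * 'C(n, i)%:R : int).

(** A binomial expansion, as left and right multiplication by x commute. *)
Lemma iter_commutator n :
  iter n (fun y => x * y - y * x) a = \sum_(i < n.+1) T (n - i) i *~ c n i.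
Proof.
elim: n => [|n IHn].
  by rewrite big_ord_recl big_ord0 /= bin0 !expr0 !mul1r mulr1 addr0.
rewrite iterS IHn mulr_sumr mulr_suml [RHS]big_ord_recl bin0 /= mulr1.
transitivity (T n.+1 0%N + \sum_(i < n.+1) T (n - i) i.+1 *~ c n i.+1 -
  \sum_(i < n.+1) T (n - i) i.+1 *~ c n i).
  congr (_ - _); last first.
    by apply: eq_bigr => i _; rewrite exprSr mulrA mulrzAl.
  rewrite big_ord_recl big_ord_recr /= bin0 bin_small // mulr0 mulr0z addr0.
  rewrite subn0 !mulr1 !mulrA -exprS; congr (_ + _).
  apply: eq_bigr => i _; rewrite /bump /= add1n mulrzAr !mulrA -exprS.
  by rewrite subnSK.
rewrite -addrA -sumrB subn0 mulr1 expr0 mulr1z; congr (_ + _).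
apply: eq_bigr => i _; rewrite /bump /= add1n subSS -mulrzBr; congr (_ *~ _).
by rewrite binS natrD mulrDr exprS !mulN1r !mulNr.
Qed.

Variables (p : nat) (charRp : p \in [pchar R]).

(** Consecutive entries of row p.-1 of Pascal's triangle add up to an entry of
    row p, which vanishes in characteristic p. *)
Lemma sign_bin_pchar i : (i < p)%N -> (-1) ^+ i * 'C(p.-1, i)%:R = 1 :> R.
Proof.
have p_gt0 := prime_gt0 (pcharf_prime charRp).
elim: i => [|i IHi] ip; first by rewrite bin0 mulr1.
have := bin_lt_pcharf_0 charRp (k := i.+1) ip.
rewrite -{1}(prednK p_gt0) binS natrD => /eqP; rewrite addr_eq0 => /eqP ->.
by rewrite exprS mulN1r mulrNN IHi // ltnW.
Qed.

Lemma iter_commutator_pred :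
  iter p.-1 (fun y => x * y - y * x) a = \sum_(i < p) T (p.-1 - i) i.
Proof.
rewrite iter_commutator prednK ?prime_gt0 ?(pcharf_prime charRp) //.
apply: eq_bigr => i _.
by rewrite -mulrzr rmorphM rmorphXn rmorphN1 rmorph_nat sign_bin_pchar ?mulr1.
Qed.

Lemma iter_commutator_pchar :
  iter p (fun y => x * y - y * x) a = x ^+ p * a - a * x ^+ p.
Proof.
have p_gt0 := prime_gt0 (pcharf_prime charRp).
rewrite -{1}(prednK p_gt0) iterS iter_commutator_pred mulr_sumr mulr_suml.
rewrite -[in LHS](prednK p_gt0) [X in X - _]big_ord_recl [X in _ - X]big_ord_recr /=.
rewrite !subn0 subnn !expr0 mulr1 mul1r !mulrA -!exprS -mulrA -exprSr prednK //.
rewrite [X in _ - X]addrC opprD addrACA -sumrB big1 ?addr0 // => i _.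
rewrite /bump /= add1n.
by rewrite !mulrA -exprS subnSK // -!mulrA -exprSr subrr.
Qed.

End Commutators.

Lemma pchar_alg (F : fieldType) (A : algType F) (p : nat) :
  p \in [pchar F] -> p \in [pchar A].
Proof. by rewrite (fmorph_pchar (in_alg A)). Qed.

Section Jacobson.
Variables (F : fieldType) (A : algType F) (a b : A).
Local Notation X := (polyX A).
(* The indeterminate commutes with a and b, which need not commute. *)
Local Notation q := ('X * a%:P + b%:P : {poly A}).

Lemma coef_pencilM (r : {poly A}) i :
  (q * r)`_i = (if i is j.+1 then a * r`_j else 0) + b * r`_i.
Proof. by rewrite mulrDl -mulrA coefD coefXM !coefCM; case: i. Qed.

Lemma coef_Mpencil (r : {poly A}) i :
  (r * q)`_i = (if i is j.+1 then r`_j * a else 0) + r`_i * b.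
Proof.
by rewrite mulrDr mulrA coefD !coefMC coefMX; case: i => [|i]; rewrite ?mul0r.
Qed.

Lemma coef_pencil_exp n :
  [/\ (q ^+ n)`_0 = b ^+ n, (q ^+ n)`_n = a ^+ n &
      forall i, (n < i)%N -> (q ^+ n)`_i = 0].
Proof.
elim: n => [|n [IH0 IHn IH]].
  by rewrite !expr0 !coef1; split=> // i; rewrite coef1; case: i.
rewrite !exprS; split=> [||[|i] // ni]; rewrite coef_pencilM ?add0r ?IH0 //.
  by rewrite IHn IH // mulr0 addr0.
by rewrite !IH ?mulr0 ?addr0 // ltnW.
Qed.

Lemma pencil_exp1 n : (a + b) ^+ n = \sum_(i < n.+1) (q ^+ n)`_i.
Proof.
have [_ _ qn0] := coef_pencil_exp n.
transitivity (q ^+ n).[1]; last first.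
  rewrite (@horner_coef_wide _ n.+1).
    by apply: eq_bigr => i _; rewrite expr1n mulr1.
  by apply/leq_sizeP => i; apply: qn0.
elim: n {qn0} => [|n IHn]; first by rewrite !expr0 hornerC.
rewrite !exprSr hornerM_comm ?IHn; last by rewrite /comm_poly mul1r mulr1.
by rewrite hornerD hornerC -(commr_polyX a%:P) hornerMX hornerC mulr1.
Qed.

Lemma deriv_pencil_exp n :
  (q ^+ n)^`() = \sum_(i < n) q ^+ (n.-1 - i) * a%:P * q ^+ i.
Proof.
have q' : q^`() = a%:P by rewrite derivD derivM derivX !derivC mulr0 !addr0 mul1r.
elim: n => [|n IHn]; first by rewrite derivC big_ord0.
rewrite exprS derivM q' IHn big_ord_recr /= subnn mul1r addrC; congr (_ + _).
rewrite mulr_sumr; apply: eq_bigr => i _; rewrite !mulrA -exprS.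
by case: n i {IHn} => [[]|n i] //=; rewrite subSn // -ltnS.
Qed.

Variables (p : nat) (charFp : p \in [pchar F]).

(** The derivative of (X a + b)^p with respect to X is the (p - 1)-fold
    commutator of X a + b with a ([deriv_pencil_exp], [iter_commutator_pred]),
    so its coefficients are sums of iterated brackets of a and b.  The i-th of
    them is i.+1 times the coefficient of degree i.+1 of (X a + b)^p, and i.+1
    is invertible as long as i.+1 < p.  Setting X = 1 adds these coefficients
    up, except for a ^+ p and b ^+ p at the two ends. *)
Lemma jacobson_formula (Y : A -> Prop) : is_subspace Y ->
  (forall y, Y y -> Y (lie_bracket a y)) ->
  (forall y, Y y -> Y (lie_bracket b y)) ->
  Y (lie_bracket b a) -> Y ((a + b) ^+ p - a ^+ p - b ^+ p).
Proof.
move=> [Y0 YD] Ya Yb Yba.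
have Yadd y z : Y y -> Y z -> Y (y + z) by rewrite -{2}[y]scale1r; apply: YD.
have charAp := pchar_alg A charFp.
have charPp : p \in [pchar {poly A}].
  by rewrite inE (pcharf_prime charFp) -polyC_natr (pcharf0 charAp) eqxx.
have p_prime := pcharf_prime charFp; have p_gt1 := prime_gt1 p_prime.
have coef_ad (r : {poly A}) i : (q * r - r * q)`_i =
    (if i is j.+1 then lie_bracket a r`_j else 0) + lie_bracket b r`_i.
  rewrite coefB coef_pencilM coef_Mpencil opprD addrACA.
  by case: i => [|i]; rewrite ?subrr.
have coefY n i : Y (iter n.+1 (fun r => q * r - r * q) a%:P)`_i.
  elim: n i => [|n IHn] i.
    rewrite coef_ad; case: i => [|[|i]]; rewrite !coefC /= ?add0r // /lie_bracket.
      by rewrite subrr mulr0 mul0r subrr addr0.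
    by rewrite !mulr0 !mul0r subrr addr0.
  rewrite iterS coef_ad; move: (iter _ _ _) IHn => r Yr.
  apply: Yadd (Yb _ (Yr i)).
  by case: i => [|i] //; apply: Ya.
have p1_gt0 : (0 < p.-1)%N by rewrite -ltnS (prednK (ltnW p_gt1)).
have coefY' i : (i.+1 < p)%N -> Y (q ^+ p)`_i.+1.
  move=> ip; have := coefY p.-2 i.
  rewrite (prednK p1_gt0) iter_commutator_pred //.
  rewrite -deriv_pencil_exp coef_deriv -scaler_nat => Yi.
  have i0 : i.+1%:R != 0 :> F by rewrite -(dvdn_pcharf charFp) gtnNdvd.
  by have := YD (i.+1%:R^-1) _ _ Yi Y0; rewrite scalerA mulVf // scale1r addr0.
have [E0 Ep _] := coef_pencil_exp p.
rewrite pencil_exp1 big_ord_recr /= Ep addrK.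
rewrite (bigD1 (Ordinal (ltnW p_gt1))) //= E0 addrAC subrr add0r.
by apply: (big_ind Y) => // -[[|i] ip] // _; apply: coefY'.
Qed.

End Jacobson.

(** * Powers of Lie elements span the restricted Lie algebra *)

Section RestrictedClosure.
Variables (F : fieldType) (A : algType F) (p : nat) (S : A -> Prop).
Hypothesis charFp : p \in [pchar F].
Implicit Types (a x y : A) (J s t n : nat).

Lemma span_mono (X Y : A -> Prop) x : (forall y, X y -> Y y) -> span X x -> span Y x.
Proof. by move=> XY; apply=> [|y /XY]; [apply: span_subspace | apply: sub_span]. Qed.

Lemma tensor_component_subspace s : is_subspace (tensor_component S s).
Proof. exact: span_subspace. Qed.

Lemma tensor_component1 : tensor_component S 0 1.
Proof.
by apply: sub_span; exists (fun=> 0); split=> [[]|] //; rewrite big_ord0.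
Qed.

Lemma tensor_componentM s t x y : tensor_component S s x ->
  tensor_component S t y -> tensor_component S (s + t) (x * y).
Proof.
have [T0 TD] := span_subspace (fun x => exists b : 'I_(s + t) -> A,
    (forall i, S (b i)) /\ x = \prod_(i < s + t) b i).
move=> Tx Ty.
apply: (Tx (fun x => tensor_component S (s + t) (x * y))) => [|{x Tx} x].
  split=> [|c u v Tu Tv]; first by rewrite mul0r.
  by rewrite mulrDl -scalerAl; apply: TD.
move=> [b [bS ->]]; apply: (Ty (fun y => tensor_component S (s + t) (_ * y))).
  split=> [|c u v Tu Tv]; first by rewrite mulr0.
  by rewrite mulrDr -scalerAr; apply: TD.
move=> {y Ty} y [b' [b'S ->]]; apply: sub_span.
exists (fun i => match split i with inl j => b j | inr j => b' j end).
split=> [i|]; first by case: (split i).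
rewrite big_split_ord /=; congr (_ * _); apply: eq_bigr => i _.
  by case: split_ordP => j /eqP; rewrite ?eq_lshift ?eq_lrshift // => /eqP ->.
by case: split_ordP => j /eqP; rewrite ?eq_rshift ?eq_rlshift // => /eqP ->.
Qed.

Lemma tensor_componentX s n x :
  tensor_component S s x -> tensor_component S (s * n) (x ^+ n).
Proof.
move=> Tx; elim: n => [|n IHn]; first by rewrite muln0; apply: tensor_component1.
by rewrite exprS mulnS; apply: tensor_componentM.
Qed.

Lemma lie_generated_bracket x y :
  lie_generated S x -> lie_generated S y -> lie_generated S (lie_bracket x y).
Proof.
by move=> Sx Sy X XL SX; apply: (XL.2); [apply: Sx | apply: Sy].
Qed.

Lemma lie_component_subspace s : is_subspace (lie_component S s).
Proof. exact: is_subspaceI (span_subspace _) (lie_generated_subspace _). Qed.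

(** The bound J on the exponent gives the filtration on which both halves of the
    main argument proceed by induction. *)
Definition homogeneous_power J s x := exists j t a,
  [/\ (j < J)%N, (t * p ^ j)%N = s, lie_component S t a & x = a ^+ (p ^ j)].

Definition power_span J s := span (homogeneous_power J s).

Lemma power_span_subspace J s : is_subspace (power_span J s).
Proof. exact: span_subspace. Qed.

Lemma power_spanD J s x y :
  power_span J s x -> power_span J s y -> power_span J s (x + y).
Proof. exact: subspaceD (power_span_subspace J s). Qed.

Lemma power_spanZ J s c x : power_span J s x -> power_span J s (c *: x).
Proof. exact: subspaceZ (power_span_subspace J s). Qed.

Lemma power_span0 s x : power_span 0 s x -> x = 0.
Proof.
move=> Yx; apply: (Yx (fun x => x = 0)) => [|y [j [t [a []]]]] //.
by split=> [|c y z -> ->]; rewrite ?scaler0 ?addr0.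
Qed.

(** This span turns out to be the restricted Lie subalgebra generated by S. *)
Definition all_powers := span (fun x => exists J s, homogeneous_power J s x).

Lemma bracket_linear_l y X : is_subspace X ->
  is_subspace (fun x : A => X (lie_bracket x y)).
Proof.
move=> [X0 XD]; split=> [|c u v Xu Xv].
  by rewrite /lie_bracket mul0r mulr0 subrr.
rewrite /lie_bracket mulrDl mulrDr -scalerAl -scalerAr opprD addrACA -scalerBr.
exact: XD.
Qed.

Lemma bracket_opp x y : lie_bracket x y = - lie_bracket y x.
Proof. by rewrite /lie_bracket opprB. Qed.

Lemma bracket_linear_r y X : is_subspace X ->
  is_subspace (fun x : A => X (lie_bracket y x)).
Proof.
move=> [X0 XD]; split=> [|c u v Xu Xv].
  by rewrite /lie_bracket mul0r mulr0 subrr.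
rewrite /lie_bracket mulrDl mulrDr -scalerAl -scalerAr opprD addrACA -scalerBr.
exact: XD.
Qed.

Lemma lie_bracket_exp x y :
  lie_bracket (x ^+ p) y = iter p (fun z => lie_bracket x z) y.
Proof.
exact/esym/iter_commutator_pchar/pchar_alg.
Qed.

Lemma lie_graded x :
  lie_generated S x -> span (fun y => exists s, lie_component S s y) x.
Proof.
set Y := span _; have YS : is_subspace Y := span_subspace _.
apply; last first.
  move=> y Sy; apply: sub_span; exists 1%N; split; last by move=> X _; apply.
  by apply: sub_span; exists (fun=> y); split=> //; rewrite big_ord1.
split=> // a b Ya Yb; apply: (Ya (fun a => Y (lie_bracket a b))).
  exact: bracket_linear_l.
move=> {a Ya} a [s [Ta La]]; apply: (Yb (fun b => Y (lie_bracket a b))).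
  exact: bracket_linear_r.
move=> {b Yb} b [t [Tb Lb]]; apply: sub_span; exists (s + t)%N; split.
  apply: subspaceB (tensor_component_subspace _) (tensor_componentM Ta Tb) _.
  by rewrite addnC; apply: tensor_componentM.
exact: lie_generated_bracket.
Qed.

(** Bracketing with a ^+ p is bracketing p times with a. *)
Lemma all_powers_normalize x y :
  all_powers x -> lie_generated S y -> lie_generated S (lie_bracket x y).
Proof.
move=> Rx Ly; have LS := lie_generated_subspace S; move: y Ly.
apply: (Rx (fun x => forall y, lie_generated S y ->
  lie_generated S (lie_bracket x y))) => [|_ [_ [_ [j [_ [a [_ _ [_ La] ->]]]]]]].
  split=> [y Ly|c u v Lu Lv y Ly]; have [X0 XD] := bracket_linear_l y LS => //.
  by apply: XD; auto.
elim: j => [|j IHj] y Ly; first by rewrite expr1; apply: lie_generated_bracket.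
rewrite expnSr exprM lie_bracket_exp; elim: {1}p => //= n IHn; exact: IHj.
Qed.

(** Of the p brackets with a power z that make up the bracket with z ^+ p, the
    first yields a Lie element, and the others do not leave the Lie algebra. *)
Lemma all_powers_bracket x y :
  all_powers x -> all_powers y -> lie_generated S (lie_bracket x y).
Proof.
move=> Rx Ry; have LS := lie_generated_subspace S.
apply: (Ry (fun y => lie_generated S (lie_bracket x y))).
  exact: bracket_linear_r.
move=> _ [J [s [j [t [a [jJ ts [Ta La] ->]]]]]].
have Rj i : all_powers (a ^+ (p ^ i)).
  by apply: sub_span; exists i.+1, (t * p ^ i)%N, i, t, a; split.
elim: j {jJ ts} => [|j IHj]; first by rewrite expr1; apply: all_powers_normalize.
rewrite bracket_opp -scaleN1r; apply: (subspaceZ _ LS).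
rewrite expnSr exprM; move: (a ^+ (p ^ j)) (Rj j) IHj => z Rz Lxz.
rewrite lie_bracket_exp -(prednK (prime_gt0 (pcharf_prime charFp))) iterSr.
elim: p.-1 => [|n IHn].
  by rewrite /= bracket_opp -scaleN1r; apply: (subspaceZ _ LS).
exact: all_powers_normalize.
Qed.

Lemma all_powers_expD x y : all_powers x -> all_powers y ->
  lie_generated S ((x + y) ^+ p - x ^+ p - y ^+ p).
Proof.
move=> Rx Ry; apply: jacobson_formula (lie_generated_subspace S) _ _ _ => //.
- by move=> z; apply: all_powers_normalize.
- by move=> z; apply: all_powers_normalize.
exact: all_powers_bracket.
Qed.

Lemma power_span_sub J s x : power_span J s x -> all_powers x.
Proof. by apply: span_mono => y; exists J, s. Qed.

Lemma lie_power_span J s a :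
  lie_component S s a -> power_span J.+1 (s * p ^ J) (a ^+ (p ^ J)).
Proof. by move=> La; apply: sub_span; exists J, s, a; split. Qed.

Lemma power_span_mono J K s x : (J <= K)%N -> power_span J s x -> power_span K s x.
Proof.
move=> JK; apply: span_mono => y [j [t [a [jJ ts La ->]]]].
by exists j, t, a; split=> //; apply: leq_trans jJ JK.
Qed.

Lemma lie_power_span1 J s a : lie_component S s a -> power_span J.+1 s a.
Proof.
move=> /(@lie_power_span 0%N); rewrite expr1 muln1; exact: power_span_mono.
Qed.

Lemma power_span_tensor J s x : power_span J s x -> tensor_component S s x.
Proof.
apply; first exact: span_subspace.
by move=> _ [j [t [a [_ <- [Ta _] ->]]]]; apply: tensor_componentX.
Qed.

Lemma power_span_expD J s x y : power_span J s x -> power_span J s y ->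
  lie_component S (s * p) ((x + y) ^+ p - x ^+ p - y ^+ p).
Proof.
move=> Yx Yy; split; last first.
  by apply: all_powers_expD; apply: power_span_sub; eassumption.
have [Tx Ty] := (power_span_tensor Yx, power_span_tensor Yy).
have TS := tensor_component_subspace.
apply: subspaceB (TS _) (subspaceB (TS _) _ _) _; apply: tensor_componentX => //.
exact: subspaceD (TS _) Tx Ty.
Qed.

(** The p-th power map is semilinear modulo Lie elements, which belong to every
    [power_span] with a positive bound; so it need only be computed on powers. *)
Lemma power_span_exp J s x : power_span J s x -> power_span J.+1 (s * p) (x ^+ p).
Proof.
have p_gt0 := prime_gt0 (pcharf_prime charFp).
move=> Yx; suff [] : power_span J s x /\ power_span J.+1 (s * p) (x ^+ p) by [].
apply: (Yx (fun x => power_span J s x /\ power_span J.+1 (s * p) (x ^+ p))).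
  split=> [|c u v [Yu Yup] [Yv Yvp]].
    by rewrite expr0n gtn_eqF //; split; apply: (power_span_subspace _ _).1.
  have Ycu := power_spanZ c Yu.
  split; first exact: power_spanD.
  have /(@lie_power_span1 J) := power_span_expD Ycu Yv.
  rewrite exprZn -addrA -opprD => YE.
  rewrite -[_ ^+ p](subrK (c ^+ p *: u ^+ p + v ^+ p)).
  by apply: power_spanD YE (power_spanD (power_spanZ _ _) _).
move=> _ [j [t [a [jJ <- La ->]]]]; split; apply: sub_span; first by exists j, t, a.
by exists j.+1, t, a; split; rewrite // expnSr ?mulnA ?exprM.
Qed.

(** The error made at the j-th of the J successive p-th powers is a Lie element,
    and is itself raised to the power p only J - j more times. *)
Lemma power_span_semilinear J s c a b : lie_component S s a -> lie_component S s b ->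
  power_span J (s * p ^ J) ((c *: a + b) ^+ (p ^ J)
    - (c ^+ (p ^ J) *: a ^+ (p ^ J) + b ^+ (p ^ J))).
Proof.
move=> La Lb; elim: J => [|J].
  by rewrite !expr1 subrr; apply: (power_span_subspace _ _).1.
set q := (p ^ J)%N; set u := c ^+ q *: a ^+ q; set v := b ^+ q => IH.
have Yu : power_span J.+1 (s * q) u by apply: power_spanZ (@lie_power_span J _ _ La).
have Yv : power_span J.+1 (s * q) v by exact: (@lie_power_span J _ _ Lb).
have := power_span_expD (power_span_mono (leqnSn J) IH) (power_spanD Yu Yv).
move/(@lie_power_span1 J); have /(@lie_power_span1 J) := power_span_expD Yu Yv.
move=> Y1 Y2; rewrite subrK in Y2.
have := power_spanD (power_spanD Y1 Y2) (power_span_exp IH).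
rewrite expnSr mulnA !exprM -exprZn -/u -/v.
by rewrite (AC (3*3*1) (4*(5*7)*((1*6)*2*3))) /= addNr addr0 subrr add0r -opprD.
Qed.

Lemma power_span_sum J s (I : Type) (r : seq I) (a : I -> A) :
  (forall i, lie_component S s (a i)) ->
  power_span J (s * p ^ J)
    ((\sum_(i <- r) a i) ^+ (p ^ J) - \sum_(i <- r) a i ^+ (p ^ J)).
Proof.
have q_gt0 : (0 < p ^ J)%N by rewrite expn_gt0 (prime_gt0 (pcharf_prime charFp)).
move=> La; elim: r => [|i r IHr].
  by rewrite !big_nil expr0n gtn_eqF // subrr; apply: (power_span_subspace _ _).1.
rewrite !big_cons; have Lr : lie_component S s (\sum_(j <- r) a j).
  by apply: (subspace_sum _ (lie_component_subspace s)).
have := power_spanD (@power_span_semilinear J s 1 _ _ (La i) Lr) IHr.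
by rewrite scale1r expr1n scale1r opprD addrA addrA subrK opprD addrA.
Qed.

Lemma power_span_restricted J s x :
  power_span J s x -> restricted_lie_component p S s x.
Proof.
move=> Yx; split; first exact: power_span_tensor Yx.
apply: Yx; first exact: restricted_lie_generated_subspace.
move=> _ [j [t [a [_ _ [_ La] ->]]]] X [XL Xp] SX.
elim: j => [|j IHj]; first by rewrite expr1; apply: La.
by rewrite expnSr exprM; apply: Xp.
Qed.

Lemma lie_all_powers x : lie_generated S x -> all_powers x.
Proof.
move=> /lie_graded; apply: span_mono => y [s Ly]; exists 1%N, s, 0%N, s, y.
by rewrite muln1.
Qed.

Lemma restricted_all_powers x : restricted_lie_generated p S x -> all_powers x.
Proof.
have RS : is_subspace all_powers := span_subspace _.
have p_gt0 := prime_gt0 (pcharf_prime charFp).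
apply=> [|y Sy]; last by apply: lie_all_powers => X _; apply.
split=> [|a Ra].
  by split=> // a b Ra Rb; exact: lie_all_powers (all_powers_bracket Ra Rb).
suff [] : all_powers a /\ all_powers (a ^+ p) by [].
apply: (Ra (fun x => all_powers x /\ all_powers (x ^+ p))).
  split=> [|c u v [Ru Rup] [Rv Rvp]].
    by split; rewrite ?expr0n ?gtn_eqF //; case: RS.
  have Rcu : all_powers (c *: u) by apply: (subspaceZ c RS).
  split; first exact: (subspaceD RS).
  have /lie_all_powers := all_powers_expD Rcu Rv.
  rewrite exprZn -addrA -opprD => RE.
  rewrite -[_ ^+ p](subrK (c ^+ p *: u ^+ p + v ^+ p)).
  exact: (subspaceD RS RE (RS.2 _ _ _ Rup Rvp)).
move=> _ [J [s [j [t [b [jJ ts Lb ->]]]]]]; split; apply: sub_span.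
  by exists J, s, j, t, b.
exists J.+1, (s * p)%N, j.+1, t, b; split=> //; last by rewrite expnSr exprM.
by rewrite expnSr mulnA ts.
Qed.

End RestrictedClosure.

(** * Degrees and separating functionals *)

Section Degrees.
Variables (F : fieldType) (V : vectType F).
Local Notation T := (tensor_algebra V).
Local Notation I := 'I_(\dim {:V}).
Local Notation word := (@word F I).
Implicit Types (x a : T) (f : T -> F) (d n r : nat).

Lemma homogeneous_word s : homogeneous (size s) (word s : T).
Proof.
move=> w; rewrite -[w]fmK mcoeff_word.
by case: (s =P w) => [<-|]; rewrite ?eqxx.
Qed.

Lemma tensor_homogeneous r n (S : T -> Prop) x :
  (forall y, S y -> homogeneous r y) -> tensor_component S n x ->
  homogeneous (n * r) x.
Proof.
move=> Sr Tx; apply/homogeneousE; apply: tensor_component_sub Tx => y Sy.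
by apply/homogeneousE; apply: Sr.
Qed.

Definition degree_part n : T -> T :=
  word_extension (fun s => if size s == n then word s else 0).

HB.instance Definition _ n := GRing.Linear.on (degree_part n).

Lemma degree_part_word n s :
  degree_part n (word s) = if size s == n then word s else 0.
Proof. exact: word_extensionE. Qed.

Lemma mcoeff_degree_part n w x :
  mcoeff w (degree_part n x) = if size w == n then mcoeff w x else 0.
Proof.
elim/free_algebra_ind: x => [|s].
  split=> [|c x y IHx IHy]; first by rewrite linear0 mcoeff0 if_same.
  rewrite linearP /= !mcoeff_linear IHx IHy.
  by case: ifP; rewrite ?mulr0 ?addr0.
rewrite degree_part_word -{1 3}[w]fmK; case: eqP => [<-|sn].
  rewrite mcoeff_word; case: (s =P w) => [->|_]; first by rewrite eqxx.
  by rewrite if_same.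
rewrite mcoeff0 mcoeff_word; case: (s =P w) => [<-|_]; last by rewrite if_same.
by rewrite (introF eqP sn).
Qed.

(** The projections onto the homogeneous components are what allows one to cut a
    presentation by powers of various degrees down to the right degree. *)
Lemma degree_part_id n x : homogeneous n x -> degree_part n x = x.
Proof.
move=> Hx; apply/malgP => w; rewrite mcoeff_degree_part; case: eqP => // wn.
by case: (eqVneq (mcoeff w x) 0) => // /Hx.
Qed.

Lemma degree_part_eq0 n d x : homogeneous d x -> d != n -> degree_part n x = 0.
Proof.
move=> Hx dn; apply/malgP => w; rewrite mcoeff_degree_part mcoeff0.
case: eqP => // wn; case: (eqVneq (mcoeff w x) 0) => // /Hx wd.
by rewrite -wd wn eqxx in dn.
Qed.

Definition graded_functional d f :=
  scalar f /\ forall s, size s != d -> f (word s) = 0.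

Lemma graded_functional_eq0 d n f x :
  graded_functional d f -> homogeneous n x -> n != d -> f x = 0.
Proof.
move=> [f_lin fd] /degree_part_id <- nd.
elim/free_algebra_ind: x => [|s].
  split=> [|c x y IHx IHy]; first by rewrite linear0 scalar0.
  by rewrite linearP /= f_lin IHx IHy mulr0 addr0.
rewrite degree_part_word; case: eqP => [sn|_]; last exact: scalar0.
by rewrite fd // sn.
Qed.

(** Gaussian elimination with functionals in place of coordinates: f0 is dual to
    the first vector v of the list, and a - f0 a *: v is the vector a with its
    v-coordinate cleared. *)
Lemma separate_homogeneous d (l : seq T) a : homogeneous d a ->
  (forall v, v \in l -> homogeneous d v) ->
  span (fun v => v \in l) a \/
  exists f, [/\ graded_functional d f, f a = 1 & forall v, v \in l -> f v = 0].
Proof.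
elim: l a => [|v l IHl] a Ha Hl.
  have [->|a0] := eqVneq a 0; first by left; apply: (span_subspace _).1.
  right; have [w aw0] : exists w, mcoeff w a != 0.
    have /fset0Pn[w] : msupp a != fset0 by rewrite msupp_eq0.
    by rewrite -mcoeff_neq0; exists w.
  exists (fun x => (mcoeff w a)^-1 * mcoeff w x); split=> //; last exact: mulVf.
  split=> [c x y|s sd]; first by rewrite mcoeff_linear mulrDr mulrCA.
  rewrite -[w]fmK mcoeff_word; case: (s =P w) => [sw|_]; last by rewrite mulr0.
  by rewrite sw (Ha _ aw0) eqxx in sd.
have span_cons x : span (fun v => v \in l) x -> span (fun u => u \in v :: l) x.
  by apply: span_mono => y; rewrite inE orbC => ->.
have Hl' u : u \in l -> homogeneous d u by move=> ul; apply: Hl; rewrite inE ul orbT.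
have Hv : homogeneous d v by apply: Hl; rewrite mem_head.
have [Lv|[f0 [[f0_lin f0d] f0v f0l]]] := IHl v Hv Hl'.
  have [La|[f [fd fa fl]]] := IHl a Ha Hl'; first by left; apply: span_cons.
  right; exists f; split=> // u; rewrite inE => /orP[/eqP ->|]; last exact: fl.
  apply: (Lv (fun x => f x = 0)) => //; case: fd => f_lin _.
  by split=> [|c x y fx fy]; rewrite ?scalar0 // f_lin fx fy mulr0 addr0.
have Ha' : homogeneous d (a - f0 a *: v).
  have HS : is_subspace (homogeneous d : T -> Prop) by apply: homogeneous_subspace.
  exact: (subspaceB HS Ha (subspaceZ _ HS Hv)).
have [La|[f [[f_lin fd] fa fl]]] := IHl _ Ha' Hl'.
  left; rewrite -[a](subrK (f0 a *: v)).
  have lS : is_subspace (span (fun u => u \in v :: l)) by apply: span_subspace.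
  apply: (subspaceD lS (span_cons _ La)); apply: (subspaceZ _ lS).
  by apply: sub_span; rewrite mem_head.
right; exists (fun x => f x - f v * f0 x); split.
- split=> [c x y|s sd]; last by rewrite fd // f0d // mulr0 subr0.
  by rewrite f_lin f0_lin mulrDr opprD addrACA mulrBr mulrCA.
- by move: fa; rewrite addrC -scaleNr f_lin mulNr addrC mulrC.
move=> u; rewrite inE => /orP[/eqP ->|ul]; first by rewrite f0v mulr1 subrr.
by rewrite fl // f0l // mulr0 subr0.
Qed.

Lemma primitive_at_lie f a :
  scalar f -> lie_generated (degree_one V) a -> primitive_at f a.
Proof.
move=> f_lin; apply: primitive_at_generated => // _ [v ->].
have fS := primitive_at_subspace f_lin.
apply: (subspace_sum _ fS) => i _; apply: (subspaceZ _ fS).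
exact: primitive_at_gen.
Qed.

Lemma homogeneous_mul_word n a s :
  homogeneous n a -> homogeneous (n + size s) (a * word s).
Proof. by move=> Ha; apply: homogeneousM => //; apply: homogeneous_word. Qed.

(** Since f lives in the degree of a, the functional [fun y => f (a * y)] lives in
    degree 0. *)
Lemma divided_power_lie f d q a : graded_functional d f ->
  lie_component (degree_one V) d a -> divided_power f q (a ^+ q) = f a ^+ q.
Proof.
move=> fd [/homogeneousE Ha La]; have aP := primitive_at_lie fd.1 La.
apply: divided_power_exp => // s s0.
apply: graded_functional_eq0 fd (homogeneous_mul_word Ha) _.
by rewrite -{2}[d]addn0 eqn_add2l size_eq0.
Qed.

(** Here [fun y => f (a * y)] vanishes, so every divided contraction of positive
    order commutes with multiplication by a, and it kills 1. *)
Lemma divided_power_lie_eq0 f d n q r a : graded_functional d f ->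
  lie_component (degree_one V) n a -> (d < n)%N -> (0 < q)%N ->
  divided_power f q (a ^+ r) = 0.
Proof.
move=> fd [/homogeneousE Ha La] dn q_gt0; have aP := primitive_at_lie fd.1 La.
apply: divided_power_exp_eq0 => // s.
apply: graded_functional_eq0 fd (homogeneous_mul_word Ha) _.
by rewrite gtn_eqF // ltn_addr.
Qed.

Variables (p : nat) (charFp : p \in [pchar F]).

(** A priori a restricted Lie element is a sum of powers of various degrees; its
    degree singles out the powers of that degree, since r is positive. *)
Lemma restricted_power_span r s (S : T -> Prop) x :
  (forall y, S y -> homogeneous r y) -> (0 < r)%N ->
  restricted_lie_component p S s x -> exists J, power_span p S J s x.
Proof.
move=> Sr r_gt0 [Tx /(restricted_all_powers charFp) Rx].
rewrite -(degree_part_id (tensor_homogeneous Sr Tx)).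
apply: (Rx (fun x => exists J, power_span p S J s (degree_part (s * r) x))).
  split=> [|c u v [Ju Yu] [Jv Yv]].
    by exists 0%N; rewrite linear0; apply: (power_span_subspace _ _ _ _).1.
  exists (maxn Ju Jv); rewrite linearP /=.
  apply: power_spanD; first apply: power_spanZ.
    by apply: power_span_mono Yu; rewrite leq_maxl.
  by apply: power_span_mono Yv; rewrite leq_maxr.
move=> y [J [t Yy]]; exists J; have Yt : power_span p S J t y by apply: sub_span.
have Hy := tensor_homogeneous Sr (power_span_tensor Yt).
have [ts|ts] := eqVneq t s; first by rewrite degree_part_id -?ts.
rewrite (degree_part_eq0 Hy) ?eqn_pmul2r //.
exact: (power_span_subspace _ _ _ _).1.
Qed.

End Degrees.

(** * The decomposition *)

Section Decomposition.
Variables (F : fieldType) (V : vectType F) (p : nat).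
Hypothesis charFp : p \in [pchar F].
Local Notation T := (tensor_algebra V).
Local Notation L := (lie_component (degree_one V)).
Variables (k : nat) (B : nat -> T -> Prop).
Hypotheses (k_gt0 : (0 < k)%N) (k_coprime : ~~ (p %| k)%N).
Hypothesis B_lie : forall i x, B i x -> L (p ^ i * k) x.
Hypothesis lie_decomposition : forall m,
  internal_direct_sum (L (p ^ m * k))
    (fun i : 'I_m.+1 => lie_component (B i) (p ^ (m - i))).

Let p_prime : prime p := pcharf_prime charFp.
Let p_gt0 : (0 < p)%N := prime_gt0 p_prime.

Lemma power_factor c t j e : ~~ (p %| c)%N -> (t * p ^ j = p ^ e * c)%N ->
  (j <= e)%N /\ t = (p ^ (e - j) * c)%N.
Proof.
move=> pc tj; have je : (j <= e)%N.
  rewrite -(dvdn_Pexp2l _ _ (prime_gt1 p_prime)) -(@Gauss_dvdl _ _ c).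
    by rewrite -tj dvdn_mull.
  by rewrite coprimeXl // prime_coprime.
have pj_gt0 : (0 < p ^ j)%N by rewrite expn_gt0 p_gt0.
split=> //; apply/eqP; rewrite -(eqn_pmul2r pj_gt0) tj.
by rewrite mulnAC -expnD subnK.
Qed.

Lemma B_lie_component i s x : lie_component (B i) s x -> L (s * (p ^ i * k)) x.
Proof.
move=> [Tx Lx]; split; first by apply: tensor_component_sub Tx => y /B_lie [].
move=> X XL VX; apply: Lx => // y /B_lie [_ Ly]; exact: Ly.
Qed.

Lemma B_lie_power m i j t x : (i <= m)%N -> (t * p ^ j = p ^ (m - i))%N ->
  lie_component (B i) t x ->
  [/\ (i + j <= m)%N, t = (p ^ (m - j - i))%N & L (p ^ (m - j) * k) x].
Proof.
have p1 : ~~ (p %| 1)%N by rewrite dvdn1 neq_ltn prime_gt1 // orbT.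
move=> im; rewrite -[RHS]muln1 => /(power_factor p1)[jm ->].
rewrite muln1 => /B_lie_component; rewrite mulnA -expnD.
have ijm : (i + j <= m)%N by rewrite -leq_subRL.
have j_le : (j <= m)%N by apply: leq_trans ijm; apply: leq_addl.
have -> : (m - i - j = m - j - i)%N by rewrite subnAC.
by rewrite subnK // leq_subRL // addnC.
Qed.

(** Families indexed by nat avoid a change of ordinal type when m varies. *)
Lemma lie_independent m (v : nat -> T) :
  (forall i, (i <= m)%N -> lie_component (B i) (p ^ (m - i)) (v i)) ->
  \sum_(i < m.+1) v i = 0 -> forall i, (i <= m)%N -> v i = 0.
Proof.
move=> Lv v0 i; rewrite -ltnS => im; have [_ /(_ v)] := lie_decomposition m.
by move=> /(_ (fun j => Lv j (ltn_ord j)) v0 (Ordinal im)).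
Qed.

Lemma B_homogeneous i x : B i x -> homogeneous (p ^ i * k) x.
Proof. by move=> /B_lie [/homogeneousE]. Qed.

Section TopLayer.
Variables m J : nat.
Local Notation q := (p ^ J)%N.
Implicit Types (i : nat) (x a : T) (l : seq (nat * T)).

(** The span of the powers with exponent below p ^ J together with finitely many
    q-th powers, q = p ^ J, of listed Lie elements; an entry (i, a) of the list
    provides a ^+ q for the i-th summand.  The list makes it possible to remove
    the powers with exponent q one by one. *)
Definition layer_span l i : T -> Prop := span (fun x =>
  homogeneous_power p (B i) J (p ^ (m - i)) x \/
  exists2 a, (i, a) \in l & x = a ^+ q).

Definition layer_list l := forall i a, (i, a) \in l ->
  (i + J <= m)%N /\ lie_component (B i) (p ^ (m - J - i)) a.

Lemma layer_span_subspace l i : is_subspace (layer_span l i).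
Proof. exact: span_subspace. Qed.

Lemma layer_span_power l i x :
  power_span p (B i) J (p ^ (m - i)) x -> layer_span l i x.
Proof. by apply: span_mono => y; left. Qed.

Lemma layer_span_listed l i a : (i, a) \in l -> layer_span l i (a ^+ q).
Proof. by move=> al; apply: sub_span; right; exists a. Qed.

Lemma layer_span_mono i l l' x :
  {subset l <= l'} -> layer_span l i x -> layer_span l' i x.
Proof.
by move=> ll'; apply: span_mono => y [hy|[a /ll' al ->]]; [left|right; exists a].
Qed.

Lemma layer_span_catl i l l' x : layer_span l i x -> layer_span (l ++ l') i x.
Proof. by apply: layer_span_mono => z; rewrite mem_cat => ->. Qed.

Lemma layer_span_catr i l l' x : layer_span l' i x -> layer_span (l ++ l') i x.
Proof. by apply: layer_span_mono => z; rewrite mem_cat orbC => ->. Qed.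

Lemma layer_list_cat l l' : layer_list l -> layer_list l' -> layer_list (l ++ l').
Proof. by move=> gl gl' i a; rewrite mem_cat => /orP[/gl|/gl']. Qed.

Lemma layer_list_cons i0 a0 l : layer_list ((i0, a0) :: l) -> layer_list l.
Proof. by move=> gl i a al; apply: gl; rewrite inE al orbT. Qed.

Lemma power_span_layer i x :
  (i <= m)%N -> power_span p (B i) J.+1 (p ^ (m - i)) x ->
  exists2 l, layer_list l & layer_span l i x.
Proof.
move=> im Yx; apply: (Yx (fun x => exists2 l, layer_list l & layer_span l i x)).
  split=> [|c x1 x2 [l1 gl1 t1] [l2 gl2 t2]].
    by exists [::] => //; apply: (layer_span_subspace [::] i).1.
  exists (l1 ++ l2); first exact: layer_list_cat.
  apply: (layer_span_subspace _ i).2; first exact: layer_span_catl.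
  exact: layer_span_catr.
move=> y [j [t [a [jJ tj La ->]]]]; have [ijm te _] := B_lie_power im tj La.
have [jJ'|Jj] := ltnP j J.
  by exists [::] => //; apply: layer_span_power; apply: sub_span; exists j, t, a.
have {jJ Jj} jJ : j = J by apply/eqP; rewrite eqn_leq -ltnS jJ.
rewrite {j}jJ in tj ijm te *; exists [:: (i, a)].
  by move=> i' a'; rewrite inE => /eqP[-> ->]; rewrite -te.
by apply: layer_span_listed; rewrite mem_head.
Qed.

Lemma power_spans_layer (u : nat -> T) :
  (forall i, (i <= m)%N -> power_span p (B i) J.+1 (p ^ (m - i)) (u i)) ->
  exists2 l, layer_list l & forall i, (i <= m)%N -> layer_span l i (u i).
Proof.
move=> Yu; suff [l gl tl] : exists2 l, layer_list l &
    forall i, (i < m.+1)%N -> layer_span l i (u i) by exists l.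
elim: {-2}m.+1 (leqnn m.+1) => [|n IHn] nm; first by exists [::].
have [l1 gl1 t1] := IHn (ltnW nm).
have [l2 gl2 t2] := power_span_layer nm (Yu n nm).
exists (l1 ++ l2) => [|i]; first exact: layer_list_cat.
rewrite ltnS leq_eqVlt => /predU1P[->|/t1]; first exact: layer_span_catr.
exact: layer_span_catl.
Qed.

Lemma layer_list_lie l i a :
  layer_list l -> (i, a) \in l -> L (p ^ (m - J) * k) a.
Proof.
move=> gl /gl[iJ /B_lie_component]; rewrite mulnA -expnD subnK //.
by rewrite leq_subRL 1?addnC //; apply: leq_trans iJ; apply: leq_addl.
Qed.

(** The directness of the decomposition of the Lie component of degree
    p ^ (m - J) * k enters here: in a relation between Lie elements coming from
    several summands, the part in each summand is a relation by itself. *)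
Lemma layer_list_dependent l i0 a0 : layer_list ((i0, a0) :: l) ->
  span (fun v => v \in [seq z.2 | z <- l]) a0 ->
  span (fun a => (i0, a) \in l) a0.
Proof.
move=> gl dep; have gl' := layer_list_cons gl.
have [i0m La0] := gl i0 a0 (mem_head _ _).
have Jm : (J <= m)%N by apply: leq_trans i0m; apply: leq_addl.
pose listed i := span (fun a => (i, a) \in l).
have listedS i : is_subspace (listed i) by apply: span_subspace.
have [v vl a0v] : exists2 v, (forall i, listed i (v i)) &
    a0 = \sum_(i < (m - J).+1) v i.
  apply: (dep (fun x => exists2 v, (forall i, listed i (v i)) &
      x = \sum_(i < (m - J).+1) v i)).
    split=> [|c x y [v vl ->] [w wl ->]].
      by exists (fun=> 0) => [i|]; [apply: (listedS i).1 | rewrite big1].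
    exists (fun i => c *: v i + w i) => [i|]; first exact: (listedS i).2.
    by rewrite scaler_sumr -big_split.
  move=> _ /mapP[[i a] al ->] /=; have [iJ _] := gl' i a al.
  exists (fun j => if j == i then a else 0) => [j|].
    by case: eqP => [->|_]; [apply: sub_span | apply: (listedS j).1].
  have im' : (i < (m - J).+1)%N by rewrite ltnS leq_subRL // addnC.
  rewrite (bigD1 (Ordinal im')) //= eqxx big1 ?addr0 // => j.
  by rewrite -val_eqE /= => /negPf ->.
have i0mJ : (i0 < (m - J).+1)%N by rewrite ltnS leq_subRL // addnC.
pose w i := v i - (if i == i0 then a0 else 0).
suff /eqP : w i0 = 0 by rewrite /w eqxx subr_eq0 => /eqP <-; apply: vl.
apply: (@lie_independent (m - J) w _ _ i0 i0mJ) => [i imJ|].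
  have LS := lie_component_subspace (B i) (p ^ (m - J - i)).
  apply: (subspaceB LS); last by case: eqP => [->|_]; [| case: LS].
  by apply: vl => // a al; case: (gl' i a al).
rewrite sumrB -a0v (bigD1 (Ordinal i0mJ)) //= eqxx.
rewrite big1 ?addr0 ?subrr // => j.
by rewrite -val_eqE /= => /negPf ->.
Qed.

Lemma layer_span_exp l i a : layer_list l -> (i + J <= m)%N ->
  span (fun b => (i, b) \in l) a -> layer_span l i (a ^+ q).
Proof.
move=> gl iJ dep; have q_gt0 : (0 < q)%N by rewrite expn_gt0 p_gt0.
have im : (i <= m)%N by apply: leq_trans iJ; apply: leq_addr.
pose s := (p ^ (m - J - i))%N.
suff [] : lie_component (B i) s a /\ layer_span l i (a ^+ q) by [].
apply: (dep (fun x => lie_component (B i) s x /\ layer_span l i (x ^+ q))).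
  have LS := lie_component_subspace (B i) s; have tS := layer_span_subspace l i.
  split=> [|c x z [Lx tx] [Lz tz]].
    by split; rewrite ?expr0n ?gtn_eqF //; [case: LS | case: tS].
  split; first exact: LS.2.
  have := power_span_semilinear (J := J) charFp c Lx Lz.
  rewrite -expnD subnAC subnK ?leq_subRL // => Yd.
  rewrite -[_ ^+ q](subrK (c ^+ q *: x ^+ q + z ^+ q)).
  by apply: (subspaceD tS) (tS.2 _ _ _ tx tz); apply: layer_span_power.
by move=> b bl; split; [case: (gl i b bl) | apply: layer_span_listed].
Qed.

Lemma divided_power_layer f l i x :
  graded_functional (p ^ (m - J) * k) f -> layer_list l ->
  (forall j a, (j, a) \in l -> f a = 0) -> (J <= m)%N -> (i <= m)%N ->
  layer_span l i x -> divided_power f q x = 0.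
Proof.
move=> fd gl fl Jm im tx; have q_gt0 : (0 < q)%N by rewrite expn_gt0 p_gt0.
apply: (tx (fun x => divided_power f q x = 0)).
  have g_lin := divided_power_linear f q.
  by split=> [|c y z y0 z0]; rewrite ?scalar0 // g_lin y0 z0 mulr0 addr0.
move=> y [[j [t [a [jJ tj La ->]]]]|[a al ->]].
  have [ijm te La'] := B_lie_power im tj La.
  apply: divided_power_lie_eq0 fd La' _ q_gt0.
  rewrite ltn_pmul2r // ltn_exp2l ?prime_gt1 //.
  by apply: ltn_sub2l => //; apply: leq_trans Jm.
by rewrite (divided_power_lie q fd (layer_list_lie gl al)) (fl i) // expr0n gtn_eqF.
Qed.

Lemma layer_span_uncons i0 a0 l i x : layer_span ((i0, a0) :: l) i x ->
  (i != i0 -> layer_span l i x) /\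
  (i = i0 -> exists c, layer_span l i0 (x - c *: a0 ^+ q)).
Proof.
move=> tx; split=> [ii0|ei].
  apply: span_mono tx => y [hy|[a]]; first by left.
  rewrite inE => /predU1P[[ei _]|al ->]; last by right; exists a.
  by rewrite ei eqxx in ii0.
have tS := layer_span_subspace l i0; rewrite {i}ei in tx.
apply: (tx (fun x => exists c, layer_span l i0 (x - c *: a0 ^+ q))).
  split=> [|c y z [cy ty] [cz tz]].
    by exists 0; rewrite scale0r subrr; case: tS.
  exists (c * cy + cz); rewrite scalerDl -scalerA opprD addrACA -scalerBr.
  exact: tS.2.
move=> y [hy|[a]].
  by exists 0; rewrite scale0r subr0; apply: sub_span; left.
rewrite inE => /predU1P[[->]|al] ->.
  by exists 1; rewrite scale1r subrr; case: tS.
by exists 0; rewrite scale0r subr0; apply: layer_span_listed.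
Qed.

(** Entries of the list are discarded from its head (i0, a0).  If a0 depends on
    the other entries, then its q-th power is redundant up to smaller exponents.
    Otherwise some f takes the value 1 at a0 and 0 at the other entries, and
    [divided_power f q] applied to the vanishing sum returns the coefficient of
    a0 ^+ q. *)
Lemma layer_span_drop l (u : nat -> T) :
  layer_list l -> (forall i, (i <= m)%N -> layer_span l i (u i)) ->
  \sum_(i < m.+1) u i = 0 ->
  forall i, (i <= m)%N -> power_span p (B i) J (p ^ (m - i)) (u i).
Proof.
move=> gl tu u0; elim: l gl tu => [|[i0 a0] l IHl] gl tu.
  by move=> i /tu; apply: span_mono => y [] // [a]; rewrite inE.
have gl' := layer_list_cons gl; have [i0m _] := gl i0 a0 (mem_head _ _).
have Jm : (J <= m)%N by apply: leq_trans i0m; apply: leq_addl.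
have i0_le : (i0 <= m)%N by apply: leq_trans i0m; apply: leq_addr.
have La0 := layer_list_lie gl (mem_head _ _).
have Hl v : v \in [seq z.2 | z <- l] -> homogeneous (p ^ (m - J) * k) v.
  by move=> /mapP[[i a] al ->]; apply/homogeneousE; case: (layer_list_lie gl' al).
have Ha0 : homogeneous (p ^ (m - J) * k) a0 by apply/homogeneousE; case: La0.
apply: IHl => // i im; have [ti ti0] := layer_span_uncons (tu i im).
have [ei|/ti //] := eqVneq i i0; rewrite {i im ti ti0}ei.
have [_ /(_ erefl)[c tc]] := layer_span_uncons (tu i0 i0_le).
have tS := layer_span_subspace l i0.
have [dep|[f [fd fa0 fl]]] := separate_homogeneous Ha0 Hl.
  rewrite -[u i0](subrK (c *: a0 ^+ q)).
  apply: (subspaceD tS tc); apply: (subspaceZ _ tS).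
  exact: layer_span_exp gl' i0m (layer_list_dependent gl dep).
pose g := divided_power f q; have g_lin : scalar g by apply: divided_power_linear.
have fl' i a : (i, a) \in l -> f a = 0.
  by move=> al; apply: fl; apply/mapP; exists (i, a).
have g0 i x : (i <= m)%N -> layer_span l i x -> g x = 0.
  exact: divided_power_layer fd gl' fl' Jm.
have g_sum : g (\sum_(i < m.+1) u i) = \sum_(i < m.+1) g (u i).
  apply: (big_morph g) => [x y|]; last exact: scalar0.
  by rewrite -[x]scale1r g_lin mul1r scale1r.
have gu : g (u i0) = 0.
  move: g_sum; rewrite u0 scalar0 // (bigD1 (Ordinal (i0_le : (i0 < m.+1)%N))) //=.
  rewrite big1 ?addr0 // => j; rewrite -val_eqE /= => ji0.
  have jm : (j <= m)%N by rewrite -ltnS.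
  by apply: (g0 j) => //; apply: (layer_span_uncons (tu j jm)).1.
suff c0 : c = 0 by rewrite c0 scale0r subr0 in tc.
apply/eqP; rewrite -oppr_eq0; apply/eqP; have := g0 i0 _ i0_le tc.
rewrite addrC -scaleNr g_lin gu addr0 /g (divided_power_lie q fd La0) fa0.
by rewrite expr1n mulr1.
Qed.

End TopLayer.

Lemma power_spans_independent m J (u : nat -> T) :
  (forall i, (i <= m)%N -> power_span p (B i) J (p ^ (m - i)) (u i)) ->
  \sum_(i < m.+1) u i = 0 -> forall i, (i <= m)%N -> u i = 0.
Proof.
elim: J u => [|J IHJ] u Yu u0; first by move=> i /Yu /power_span0.
have [l gl tu] := power_spans_layer Yu.
exact: IHJ (layer_span_drop gl tu u0) u0.
Qed.

(** The finitely many u i have a common bound on the exponents they need. *)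
Lemma restricted_independent m (u : 'I_m.+1 -> T) :
  (forall i : 'I_m.+1, restricted_lie_component p (B i) (p ^ (m - i)) (u i)) ->
  \sum_i u i = 0 -> forall i, u i = 0.
Proof.
move=> Ru u0; have p_i_gt0 (i : nat) : (0 < p ^ i * k)%N.
  by rewrite muln_gt0 expn_gt0 p_gt0.
have /fin_all_exists[J YJ] (i : 'I_m.+1) :=
  restricted_power_span charFp (@B_homogeneous i) (p_i_gt0 i) (Ru i).
move=> i; have := @power_spans_independent m (\max_i J i) (fun j => u (inord j)).
rewrite (eq_bigr u) => [ind|j _]; last by rewrite inord_val.
rewrite -[i]inord_val; apply: ind => //; last by rewrite -ltnS.
move=> j jm; apply: power_span_mono (leq_bigmax (inord j)) _.
by have := YJ (inord j); rewrite inordK.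
Qed.

Lemma restricted_spanned m J x : power_span p (degree_one V) J (p ^ m * k) x ->
  exists u : 'I_m.+1 -> T,
    (forall i : 'I_m.+1, restricted_lie_component p (B i) (p ^ (m - i)) (u i)) /\
    x = \sum_i u i.
Proof.
pose Q x := exists u : 'I_m.+1 -> T,
  (forall i : 'I_m.+1, restricted_lie_component p (B i) (p ^ (m - i)) (u i)) /\
  x = \sum_i u i.
have RS i : is_subspace (restricted_lie_component p (B i) (p ^ (m - i))).
  exact: is_subspaceI (span_subspace _) (restricted_lie_generated_subspace _ _).
have QS : is_subspace Q.
  split=> [|c y z [u [Ru ->]] [v [Rv ->]]].
    by exists (fun=> 0); split=> [i|]; [apply: (RS i).1 | rewrite big1].
  exists (fun i => c *: u i + v i); split=> [i|]; first exact: (RS i).2.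
  by rewrite scaler_sumr -big_split.
have QR (i : 'I_m.+1) y : restricted_lie_component p (B i) (p ^ (m - i)) y -> Q y.
  move=> Ry; exists (fun j => if j == i then y else 0); split=> [j|].
    by case: eqP => [->|_] //; apply: (RS j).1.
  by rewrite (bigD1 i) //= eqxx big1 ?addr0 // => j /negPf ->.
rewrite -/(Q x); elim: J x => [|J IHJ] x Yx.
  by rewrite (power_span0 Yx); case: QS.
apply: Yx => // y [j [t [a [jJ tj La ->]]]].
have [jJ'|Jj] := ltnP j J; first by apply: IHJ; apply: sub_span; exists j, t, a.
have {jJ Jj} jJ : j = J by apply/eqP; rewrite eqn_leq -ltnS jJ.
rewrite {j}jJ in tj *; have [Jm tE] := power_factor k_coprime tj.
rewrite tE in La; have [/(_ a)[/(_ La)[v [Lv av]] _] _] := lie_decomposition (m - J).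
have i_le (i : 'I_(m - J).+1) : (i <= m - J)%N by rewrite -ltnS.
have iJ_le (i : 'I_(m - J).+1) : (i + J <= m)%N by rewrite addnC -leq_subRL.
have i_lt (i : 'I_(m - J).+1) : (i < m.+1)%N.
  by rewrite ltnS; apply: leq_trans (iJ_le i); apply: leq_addr.
have Lv' i : L t (v i).
  by have /B_lie_component := Lv i; rewrite mulnA -expnD subnK // tE.
have := power_span_sum (J := J) charFp (index_enum 'I_(m - J).+1) Lv'.
rewrite -av tj => /IHJ Qd; rewrite -[_ ^+ _](subrK (\sum_i v i ^+ (p ^ J))).
apply: (subspaceD QS Qd); apply: (subspace_sum _ QS) => i _.
apply: (QR (Ordinal (i_lt i))); apply: (@power_span_restricted _ _ _ _ J.+1).
have := lie_power_span (p := p) (J := J) (Lv i).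
by rewrite -expnD subnAC subnK // leq_subRL // -ltnS i_lt.
Qed.

Lemma restricted_decomposition m :
  internal_direct_sum (restricted_lie_component p (degree_one V) (p ^ m * k))
    (fun i : 'I_m.+1 => restricted_lie_component p (B i) (p ^ (m - i))).
Proof.
split=> [x|]; last exact: restricted_independent.
have V1 y : degree_one V y -> homogeneous 1 y.
  by move=> [v ->]; apply: homogeneous_vector.
split=> [/(restricted_power_span charFp V1 isT)[J]|[u [Ru ->]]].
  exact: restricted_spanned.
have RS : is_subspace (restricted_lie_component p (degree_one V) (p ^ m * k)).
  exact: is_subspaceI (span_subspace _) (restricted_lie_generated_subspace _ _).
apply: (subspace_sum _ RS) => i _; have [Tu Gu] := Ru i; split.
  have := tensor_component_sub (fun y By => (B_lie By).1) Tu.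
  by rewrite mulnA -expnD subnK // -ltnS.
move=> X XR VX; apply: Gu => // y /B_lie[_]; apply=> //; exact: XR.1.
Qed.

End Decomposition.

Theorem theorem2p2 (F : fieldType) (p : nat) (charFp : p \in [pchar F])
  (G : groupType) (V : vectType F) (rho : G -> 'End(V))
  (rho_action : is_linear_action rho)
  (B : nat -> tensor_algebra V -> Prop)
  (B_submodule : forall r : nat, (0 < r)%N ->
     is_FG_submodule rho (B r) /\
     (forall x, B r x -> lie_component (degree_one V) r x))
  (B_summand : forall r : nat, (0 < r)%N ->
     is_direct_summand rho (tensor_component (degree_one V) r) (B r))
  (B_decomposition : forall k m : nat, (0 < k)%N -> ~~ (p %| k)%N ->
     internal_direct_sum (lie_component (degree_one V) (p ^ m * k))
       (fun i : 'I_m.+1 => lie_component (B (p ^ i * k)%N) (p ^ (m - i)))) :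
  forall k m : nat, (0 < k)%N -> ~~ (p %| k)%N ->
    internal_direct_sum (restricted_lie_component p (degree_one V) (p ^ m * k))
      (fun i : 'I_m.+1 =>
         restricted_lie_component p (B (p ^ i * k)%N) (p ^ (m - i))).
Proof.
move=> k m k_gt0 pk.
apply: (restricted_decomposition charFp (B := fun i => B (p ^ i * k)%N)) => //.
  move=> i x; apply: (B_submodule _ _).2.
  by rewrite muln_gt0 expn_gt0 prime_gt0 ?(pcharf_prime charFp).
by move=> n; apply: B_decomposition.
Qed.
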